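(* Let $\mathcal{A}$ be an $\mathbb{N}$-graded cluster algebra of geometric type over a field $\mathbb{K}$ of characteristic $0$, equipped with a Gekhtman--Shapiro--Vainshtein Poisson structure $\{.,.\}$. Let $\Sigma=(y_1,\ldots,y_m,\widetilde B)$ be a labeled seed of $\mathcal{A}$ such that $y_1,\ldots,y_m$ are homogeneous of positive degrees. Then for every unipotent automorphism $\phi$ of the Poisson algebra $(\mathcal{A},\{.,.\})$, $$\phi(y_k)\,y_k^{-1}\in\mathcal{Z}(\mathbb{K}[y_1^{\pm1},\ldots,y_m^{\pm1}])\qquad\forall\,k\in\{1,\ldots,m\},$$ where the Poisson center $\mathcal{Z}$ is computed with respect to the induced Poisson structure on the localization $\mathbb{K}[y_1^{\pm1},\ldots,y_m^{\pm1}]=\mathcal{A}[y_1^{-1},\ldots,y_m^{-1}]$.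
   Context: $\mathbb{N}=\{0,1,\ldots\}$. Cluster algebras of geometric type are in the sense of Fomin--Zelevinsky, with base ring extended from $\mathbb{Z}$ to $\mathbb{K}$. A labeled seed $\Sigma=(y_1,\ldots,y_m,\widetilde B)$ consists of cluster variables $y_1,\ldots,y_m$, of which $y_1,\ldots,y_n$ are exchangeable and $y_{n+1},\ldots,y_m$ are frozen, and an $m\times n$ integer exchange matrix $\widetilde B=(b_{ij})$ whose principal $n\times n$ submatrix is skew-symmetrizable. By the Laurent phenomenon $\mathbb{K}[y_1,\ldots,y_m]\subseteq\mathcal{A}\subseteq\mathbb{K}[y_1^{\pm1},\ldots,y_m^{\pm1}]$. Let $B$ denote the principal $n\times n$ submatrix of $\widetilde B$ and $d_1,\ldots,d_n$ positive relatively prime integers with $\operatorname{diag}(d_1,\ldots,d_n)B$ skewsymmetric. A skewsymmetric integral $m\times m$ matrix $\Lambda=(\lambda_{jk})$ is compatible with $\widetilde B$ if the principal $n\times n$ submatrix of $-\Lambda\widetilde B$ equals $\operatorname{diag}(d_1,\ldots,d_n)$ and all other entries of $-\Lambda\widetilde B$ vanish. Under mutation in direction $k\in\{1,\ldots,n\}$, $\Lambda$ is replaced by $E_k^t\Lambda E_k$, where $E_k=(e_{ij})$ is the $m\times m$ matrix with $e_{ij}=\delta_{ij}$ if $j\neq k$, $e_{kk}=-1$, $e_{ik}=\max(0,b_{ik})$ if $i\neq k$; the new matrix is compatible with the mutated exchange matrix. In this way, starting from a compatible pair in one seed, one attaches a compatible matrix to every labeled seed. The associated Gekhtman--Shapiro--Vainshtein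 Poisson structure on $\mathcal{A}$ is the Poisson bracket which in each labeled seed is given by $\{y_j,y_k\}=\lambda_{jk}y_jy_k$ for all $j,k\in\{1,\ldots,m\}$, where $(\lambda_{jk})$ is the compatible matrix attached to that seed. $\mathcal{A}$ is $\mathbb{N}$-graded: $\mathcal{A}=\bigoplus_{n\in\mathbb{N}}\mathcal{A}_n$. A unipotent automorphism of $(\mathcal{A},\{.,.\})$ is a Poisson algebra automorphism $\phi$ with $\phi(f)-f\in\bigoplus_{l>n}\mathcal{A}_l$ for all $n\in\mathbb{N}$, $f\in\mathcal{A}_n$. The Poisson center of a Poisson algebra $\mathcal P$ is $\mathcal{Z}(\mathcal P)=\{z\in\mathcal P\mid\{z,f\}=0\ \forall f\in\mathcal P\}$. *)

(* Defs.v *)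
From HB Require Import structures.
From mathcomp Require Import all_boot all_order all_algebra.
From mathcomp.multinomials Require Import mpoly.
Set Implicit Arguments.
Unset Strict Implicit.
Unset Printing Implicit Defensive.
Import Order.TTheory GRing.Theory Num.Theory.
Local Open Scope ring_scope.

(* Everything lives in an ambient field F, made a K-algebra by iota : K -> F.
   Subalgebras of F and their graded pieces are predicates F -> Prop; brackets
   and automorphisms of a subalgebra are functions on F that are constrained
   (and used) only on that subalgebra. *)

Section Algebras.
Variables (K F : fieldType) (iota : {rmorphism K -> F}).

Inductive subalg_gen (S : F -> Prop) : F -> Prop :=
| subalg_scalar c : subalg_gen S (iota c)
| subalg_in x of S x : subalg_gen S x
| subalg_add x y of subalg_gen S x & subalg_gen S y : subalg_gen S (x + y)
| subalg_mul x y of subalg_gen S x & subalg_gen S y : subalg_gen S (x * y).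

Record is_poisson (P : F -> Prop) (br : F -> F -> F) : Prop := {
  br_closed : forall a b, P a -> P b -> P (br a b);
  br_linear : forall k a b c, P a -> P b -> P c ->
    br (iota k * a + b) c = iota k * br a c + br b c;
  br_antisym : forall a b, P a -> P b -> br a b = - br b a;
  br_jacobi : forall a b c, P a -> P b -> P c ->
    br a (br b c) + br b (br c a) + br c (br a b) = 0;
  br_leibniz : forall a b c, P a -> P b -> P c ->
    br a (b * c) = br a b * c + b * br a c }.

Definition poisson_center (P : F -> Prop) (br : F -> F -> F) (z : F) : Prop :=
  P z /\ forall f, P f -> br z f = 0.

Record is_poisson_aut (P : F -> Prop) (br : F -> F -> F) (phi : F -> F) :
    Prop := {
  aut_closed : forall a, P a -> P (phi a);
  aut_scalar : forall c, phi (iota c) = iota c;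
  aut_add : forall a b, P a -> P b -> phi (a + b) = phi a + phi b;
  aut_mul : forall a b, P a -> P b -> phi (a * b) = phi a * phi b;
  aut_inj : forall a b, P a -> P b -> phi a = phi b -> a = b;
  aut_surj : forall b, P b -> exists2 a, P a & phi a = b;
  aut_br : forall a b, P a -> P b -> phi (br a b) = br (phi a) (phi b) }.

(* gr d is the homogeneous component of degree d of P. *)
Record is_grading (P : F -> Prop) (gr : nat -> F -> Prop) : Prop := {
  gr_sub : forall d a, gr d a -> P a;
  gr_zero : forall d, gr d 0;
  gr_linear : forall d k a b, gr d a -> gr d b -> gr d (iota k * a + b);
  gr_span : forall a, P a -> exists (N : nat) (c : nat -> F),
    (forall d, gr d (c d)) /\ a = \sum_(d < N) c d;
  gr_direct : forall (N : nat) (c : nat -> F), (forall d, gr d (c d)) ->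
    \sum_(d < N) c d = 0 -> forall d, (d < N)%N -> c d = 0;
  gr_one : gr 0%N 1;
  gr_mul : forall d e a b, gr d a -> gr e b -> gr (d + e)%N (a * b) }.

(* Membership in the direct sum of the components of degree > d. *)
Definition gr_above (gr : nat -> F -> Prop) (d : nat) (f : F) : Prop :=
  exists (N : nat) (c : nat -> F),
    (forall l, gr l (c l)) /\ f = \sum_(d.+1 <= l < N) c l.

Definition is_unipotent (gr : nat -> F -> Prop) (phi : F -> F) : Prop :=
  forall d f, gr d f -> gr_above gr d (phi f - f).

End Algebras.

(* A labeled seed with m = n + r cluster variables: indices lshift r k are
   exchangeable, indices rshift n j are frozen. *)
Record seed (F : Type) (n r : nat) := Seed {
  cvar : {ffun 'I_(n + r) -> F};
  exmx : 'M[int]_(n + r, n) }.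

Section ExchangeMatrices.
Variables (n r : nat).
Implicit Type B : 'M[int]_(n + r, n).

Definition sym_mx (d : 'I_n -> nat) : 'M[int]_n :=
  diag_mx (\row_i (d i)%:Z).

Definition skew_symmetrizes (d : 'I_n -> nat) B : Prop :=
  (forall i, (0 < d i)%N) /\
  (sym_mx d *m usubmx B)^T = - (sym_mx d *m usubmx B).

(* "<= 1" rather than "= 1" only matters for n = 0, where the gcd is 0. *)
Definition relatively_prime (d : 'I_n -> nat) : Prop :=
  (\big[gcdn/0%N]_(i < n) d i <= 1)%N.

Definition compatible (d : 'I_n -> nat) B (L : 'M[int]_(n + r)) : Prop :=
  L^T = - L /\ - (L *m B) = col_mx (sym_mx d) 0.

Definition mutate_exmx (k : 'I_n) B : 'M[int]_(n + r, n) :=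
  \matrix_(i, j)
    if (i == lshift r k) || (j == k) then - B i j
    else B i j + Num.sg (B i k) * Num.max 0 (B i k * B (lshift r k) j).

Definition E_mx (k : 'I_n) B : 'M[int]_(n + r) :=
  \matrix_(i, j)
    if j != lshift r k then (i == j)%:R
    else if i == lshift r k then -1 else Num.max 0 (B i k).

Definition mutate_compat (k : 'I_n) B (L : 'M[int]_(n + r)) :
    'M[int]_(n + r) :=
  (E_mx k B)^T *m L *m E_mx k B.

End ExchangeMatrices.

Section Seeds.
Variables (F : fieldType) (n r : nat).
Implicit Type s : seed F n r.

Definition mutate_seed (k : 'I_n) s : seed F n r :=
  let y := cvar s in let B := exmx s in
  Seed [ffun i =>
          if i == lshift r k then
            (\prod_j y j ^ Num.max 0 (B j k)
             + \prod_j y j ^ Num.max 0 (- B j k)) / y i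
          else y i]
       (mutate_exmx k B).

Inductive mut_equiv s : seed F n r -> Prop :=
| mut_refl : mut_equiv s s
| mut_step k t of mut_equiv s t : mut_equiv s (mutate_seed k t).

(* attached s L t M: starting from the matrix L in the seed s, the matrix M is
   attached to the seed t by some sequence of mutations from s to t. *)
Inductive attached s (L : 'M[int]_(n + r)) :
    seed F n r -> 'M[int]_(n + r) -> Prop :=
| attached_refl : attached s L s L
| attached_step k t M of attached s L t M :
    attached s L (mutate_seed k t) (mutate_compat k (exmx t) M).

End Seeds.

Section ClusterAlgebras.
Variables (K F : fieldType) (iota : {rmorphism K -> F}) (n r : nat).
Implicit Type s : seed F n r.

(* The cluster variables (frozen ones included) are algebraically independent
   over K and generate F as a field extension of K. *)
Definition free_generating (y : 'I_(n + r) -> F) : Prop :=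
  (forall p : {mpoly K[n + r]}, mmap iota y p = 0 -> p = 0) /\
  (forall f : F, exists p q : {mpoly K[n + r]},
      mmap iota y q != 0 /\ f = mmap iota y p / mmap iota y q).

Definition is_seed s : Prop :=
  free_generating (cvar s) /\
  exists d : 'I_n -> nat, skew_symmetrizes d (exmx s).

(* Generated over K by all cluster variables of all seeds mutation equivalent
   to s; frozen variables are not inverted. *)
Definition cluster_algebra s : F -> Prop :=
  subalg_gen iota (fun x => exists (t : seed F n r) (i : 'I_(n + r)),
    mut_equiv s t /\ x = cvar t i).

Definition laurent_ring s : F -> Prop :=
  subalg_gen iota (fun x => exists i : 'I_(n + r),
    x = cvar s i \/ x = (cvar s i)^-1).

(* br is a Gekhtman--Shapiro--Vainshtein bracket on the cluster algebra of s. *)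
Definition is_GSV s (br : F -> F -> F) : Prop :=
  is_poisson iota (cluster_algebra s) br /\
  exists (d : 'I_n -> nat) (L : 'M[int]_(n + r)),
    [/\ skew_symmetrizes d (exmx s), relatively_prime d,
        compatible d (exmx s) L &
        forall t M, attached s L t M -> forall j k : 'I_(n + r),
          br (cvar t j) (cvar t k) = (M j k)%:~R * (cvar t j * cvar t k)].

(* brL is the bracket induced by br on the Laurent polynomial ring of t, a
   localization of the cluster algebra of s: a biderivation on a localization
   is determined by its restriction, so brL is unique (on that ring). *)
Definition induced_bracket s t (br brL : F -> F -> F) : Prop :=
  is_poisson iota (laurent_ring t) brL /\
  forall a b, cluster_algebra s a -> cluster_algebra s b -> brL a b = br a b.

End ClusterAlgebras.

(* Main.v *)
Require Import Defs.
From HB Require Import structures.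
From mathcomp Require Import all_boot all_order all_algebra.
From mathcomp.multinomials Require mpoly.
From mathcomp Require Import ring zify.
Set Implicit Arguments.
Unset Strict Implicit.
Unset Printing Implicit Defensive.
Import Order.TTheory GRing.Theory Num.Theory.
Local Open Scope ring_scope.

(** Two theorems carry the proof: the Laurent phenomenon, which puts the cluster
    algebra A inside the Laurent ring T of the chosen seed y, and a rigidity
    theorem for the log-canonical Poisson structure of T.

    Rigidity.  Clearing denominators by a monomial shows that the abstract
    grading of A is the restriction of the grading of T by monomial degrees
    ([gr_expansion]).  Hence phi(y_k) = y_k u_k and phi^-1(y_k) = y_k v_k where
    u_k and v_k are 1 plus Laurent polynomials whose exponents have positive
    degree; the inverse is handled by [unipotent_inverse].  Write lam for the
    bilinear form of the compatible matrix, so that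
    {y^a, y^b} = lam(a,b) y^(a+b), and sqnorm(s) = sum_j lam(e_j,s)^2, which
    vanishes exactly when y^s is central.  If some exponent of the u_k, v_k is
    not central, let p be one that maximises sqnorm(s) / deg(s)^2.  On
    the slice deg = 1 the function sqnorm is strictly convex modulo the radical
    of lam, so it is maximal at a vertex: p gives an integral linear form
    [height] that is nonnegative on all the exponents, and an exponent s of
    height 0 is proportional to p modulo the radical ([maximal_slope]).
    Keeping only the terms of height 0 is a ring morphism which turns u_k and
    v_k into polynomials P_k and V_k in one variable (recording the degree), and
    the face of height 0 Poisson commutes.  There
    the equation {phi(y_j), phi(y_k)} = lam_jk phi(y_j) phi(y_k) says that the
    logarithmic derivatives of the P_k are proportional to the numbers
    lam(e_k,p) ([lead_poisson]); as lam is alternating, the product of the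
    P_k^(s_k) is 1 for each s in the face, that is, phi fixes y^s at leading
    order.  So phi(phi^-1(y_k)) = y_k becomes P_k V_k = 1 ([lead_inverse]), and
    the polynomials P_k = V_k = 1 have no term at p, a contradiction.  Thus all
    the exponents of u_k are central ([rigidity]).

    Laurent phenomenon.  A compatible pair forces the exchange matrix to have a
    left inverse over the rationals, a property that mutation preserves; so for
    every direction k there is a weight grading for which the exchange binomial
    of k has two terms of different weights while all other exchange relations
    are homogeneous.  Weights are realised by the torus action
    y_i -> y_i t^(w_i) on the fraction field.  For j <> k, an element which is
    Laurent in a seed t, in mu_j t and in mu_k t is Laurent in mu_j mu_k t: the
    first two conditions make it a polynomial in y_j, in its mutation, and in
    the other variables and their inverses ([laurent_inter_exchange_ring]), so
    that it becomes Laurent in mu_j mu_k t after multiplication by a power of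
    the exchange binomial Q of k; and Q can be cancelled by comparing extremal
    components for the weight grading ([cancel_exchange_poly]).  Consequently
    the upper bound of a seed does not depend on the seed
    ([upper_bound_mutate]), and it contains all cluster variables. *)

(** * Laurent monomials and formal Laurent polynomials *)

Section LaurentMonomials.
Import mpoly.
Variables (F : fieldType) (m : nat).
Implicit Types (y z : 'I_m -> F) (s : 'rV[int]_m).

Definition mono y s : F := \prod_i y i ^ s 0 i.

Lemma mono_row0 y : mono y 0 = 1.
Proof. by rewrite /mono big1 // => i _; rewrite mxE expr0z. Qed.

Lemma monoD y s1 s2 : (forall i, y i != 0) ->
  mono y (s1 + s2) = mono y s1 * mono y s2.
Proof.
move=> nz; rewrite /mono -big_split /=; apply: eq_bigr => i _.
by rewrite mxE expfzDr.
Qed.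

Lemma mono_neq0 y s : (forall i, y i != 0) -> mono y s != 0.
Proof. by move=> nz; apply/prodf_neq0 => i _; rewrite expfz_neq0. Qed.

Lemma monoN y s : (forall i, y i != 0) -> mono y (- s) = (mono y s)^-1.
Proof.
move=> nz; apply: (mulfI (mono_neq0 s nz)).
by rewrite -monoD // subrr mono_row0 divff // mono_neq0.
Qed.

Lemma mono_delta y k : mono y (delta_mx 0 k) = y k.
Proof.
rewrite /mono (bigD1 k) //= mxE !eqxx expr1z big1 ?mulr1 // => i ik.
by rewrite mxE (negbTE ik) andbF expr0z.
Qed.

Lemma monoM y z s : mono (fun i => y i * z i) s = mono y s * mono z s.
Proof. by rewrite /mono -big_split; apply: eq_bigr => i _; rewrite expfzMl. Qed.

Lemma eq_mono y z s : y =1 z -> mono y s = mono z s.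
Proof. by move=> e; apply: eq_bigr => i _; rewrite e. Qed.

Lemma mono_nat y (a : 'X_{1.. m}) : mono y (\row_i (a i)%:Z) = mmap1 y a.
Proof. by rewrite /mono /mmap1; apply: eq_bigr => i _; rewrite mxE. Qed.

End LaurentMonomials.

(** Laurent polynomials are handled as lists of terms, which can be evaluated
    under any function of the exponents, multiplicative or not. *)
Section FormalLaurent.
Import mpoly.
Variables (K : fieldType) (m : nat).
Implicit Types (s : 'rV[int]_m) (f g : seq (K * 'rV[int]_m)).

Definition lsum (R : nzRingType) (j : K -> R) (h : 'rV[int]_m -> R) f : R :=
  \sum_(x <- f) j x.1 * h x.2.

Definition lmul f g : seq (K * 'rV[int]_m) :=
  [seq (x.1 * y.1, x.2 + y.2) | x <- f, y <- g].

Definition lshiftl s f : seq (K * 'rV[int]_m) := [seq (x.1, s + x.2) | x <- f].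

Lemma lsum_cat (R : nzRingType) (j : K -> R) h f g :
  lsum j h (f ++ g) = lsum j h f + lsum j h g.
Proof. exact: big_cat. Qed.

Lemma lsum1 (R : nzRingType) (j : {rmorphism K -> R}) h s :
  lsum j h [:: (1, s)] = h s.
Proof. by rewrite /lsum big_seq1 rmorph1 mul1r. Qed.

(** Truncation to a face of a cone is multiplicative on that cone only, hence the
    restriction of the hypothesis to the exponents that occur. *)
Lemma lsum_mul (R : comNzRingType) (j : {rmorphism K -> R}) h f g :
  (forall x y, x \in f -> y \in g -> h (x.2 + y.2) = h x.2 * h y.2) ->
  lsum j h (lmul f g) = lsum j h f * lsum j h g.
Proof.
move=> hM; rewrite /lsum big_allpairs_dep mulr_suml [LHS]big_seq [RHS]big_seq.
apply: eq_bigr => x xf; rewrite mulr_sumr big_seq [RHS]big_seq.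
by apply: eq_bigr => y yg /=; rewrite hM // rmorphM mulrACA.
Qed.

Lemma lsum_shift (R : comNzRingType) (j : K -> R) h s f :
  (forall x, x \in f -> h (s + x.2) = h s * h x.2) ->
  lsum j h (lshiftl s f) = h s * lsum j h f.
Proof.
move=> hM; rewrite /lsum big_map mulr_sumr [LHS]big_seq [RHS]big_seq.
by apply: eq_bigr => x xf; rewrite hM //= mulrCA.
Qed.

Lemma mem_lmul f g z : z \in lmul f g ->
  exists x y, [/\ x \in f, y \in g & z.2 = x.2 + y.2].
Proof. by case/allpairsP=> -[x y] /= [xf yg ->]; exists x, y. Qed.

Lemma exponents_bounded f :
  exists N : nat, forall x, x \in f -> forall i, 0 <= x.2 0 i + N%:Z.
Proof.
exists (\sum_(x <- f) \sum_i `|x.2 0%R i|)%N => x xf i.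
rewrite (big_rem x) //= (bigD1 i) //=; lia.
Qed.

Definition shifted_monomial (N : nat) s : 'X_{1.. m} :=
  [multinom absz (s 0 i + N%:Z)%R | i < m].

Definition unshifted (N : nat) (a : 'X_{1.. m}) : 'rV[int]_m :=
  \row_i ((a i)%:Z - N%:Z).

Lemma shifted_monomialK (N : nat) s : (forall i, 0 <= s 0 i + N%:Z) ->
  unshifted N (shifted_monomial N s) = s.
Proof.
move=> sN; apply/rowP=> i; rewrite mxE mnmE.
by have := sN i; lia.
Qed.

Definition polynomial_of (N : nat) f : {mpoly K[m]} :=
  \sum_(x <- f) x.1 *: 'X_[shifted_monomial N x.2].

Lemma mmap_polynomial_of (F : fieldType) (iota : {rmorphism K -> F})
    (z : 'I_m -> F) N f : (forall i, z i != 0) ->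
  (forall x, x \in f -> forall i, 0 <= x.2 0 i + N%:Z) ->
  mmap iota z (polynomial_of N f) =
    mono z (const_mx N%:Z) * lsum iota (mono z) f.
Proof.
move=> nz fN; rewrite /polynomial_of raddf_sum /= /lsum mulr_sumr.
rewrite big_seq [RHS]big_seq; apply: eq_bigr => x xf.
rewrite mmapZ mmapX mulrCA -mono_nat -monoD //; congr (_ * mono z _).
apply/rowP=> i; rewrite !mxE mnmE.
by rewrite gez0_abs ?(fN x xf i) // addrC.
Qed.

Variables (F : fieldType) (iota : {rmorphism K -> F}) (y : 'I_m -> F).
Hypothesis indep : forall p : {mpoly K[m]}, mmap iota y p = 0 -> p = 0.

Lemma indep_neq0 i : y i != 0.
Proof.
apply/eqP=> y0.
have /indep/eqP : mmap iota y ('X_i : {mpoly K[m]}) = 0.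
  by rewrite mmapX mmap1U.
by move/eqP/(congr1 (mcoeff U_(i))); rewrite mcoeffX eqxx mcoeff0 => /eqP;
  rewrite oner_eq0.
Qed.

(** Distinct Laurent monomials are linearly independent over K, so any function of
    the exponents extends to a linear function of the value of a formal sum.
    This is how truncations are applied to identities between elements of the
    field. *)
Lemma lsum_indep (R : comNzRingType) (j : {rmorphism K -> R}) h f g :
  lsum iota (mono y) f = lsum iota (mono y) g -> lsum j h f = lsum j h g.
Proof.
have key f0 : lsum iota (mono y) f0 = 0 -> lsum j h f0 = 0.
  have [N fN] := exponents_bounded f0 => f00.
  have p0 : polynomial_of N f0 = 0.
    by apply: indep; rewrite mmap_polynomial_of ?f00 ?mulr0 //; exact: indep_neq0.
  pose d := (\sum_(x <- f0) mdeg (shifted_monomial N x.2)).+1.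
  have -> : lsum j h f0 =
      \sum_(a : 'X_{1..m < d}) j (polynomial_of N f0)@_a * h (unshifted N a).
    under eq_bigr do rewrite /polynomial_of raddf_sum rmorph_sum mulr_suml /=.
    rewrite exchange_big /= /lsum big_seq [RHS]big_seq.
    apply: eq_bigr => x xf.
    have dx : (mdeg (shifted_monomial N x.2) < d)%N.
      by rewrite /d ltnS (big_rem x) //= leq_addr.
    rewrite (bigD1 (BMultinom dx)) //= mcoeffZ mcoeffX eqxx mulr1.
    rewrite shifted_monomialK; last exact: fN.
    rewrite big1 ?addr0 // => a ax; rewrite mcoeffZ mcoeffX.
    case: eqP => [e|]; last by rewrite mulr0 rmorph0 mul0r.
    by case/eqP: ax; apply/val_inj => /=.
  by rewrite p0; apply: big1 => a _; rewrite mcoeff0 rmorph0 mul0r.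
have lsumN (R' : nzRingType) (j' : {rmorphism K -> R'}) h' f0 :
    lsum j' h' [seq (- x.1, x.2) | x <- f0] = - lsum j' h' f0.
  by rewrite /lsum big_map -sumrN; apply: eq_bigr => x _; rewrite rmorphN mulNr.
move=> fg; apply/eqP; rewrite -subr_eq0 -lsumN -lsum_cat; apply/eqP.
by apply: key; rewrite lsum_cat lsumN fg subrr.
Qed.

(** The normal form makes the support of a Laurent polynomial visible: no
    cancellation is left between the terms of the list. *)
Lemma lsum_normal f : exists g, [/\ lsum iota (mono y) g = lsum iota (mono y) f,
  uniq (map snd g), (forall x, x \in g -> x.1 != 0) &
  forall x, x \in g -> exists2 z, z \in f & z.2 = x.2].
Proof.
have [N fN] := exponents_bounded f.
pose p := polynomial_of N f.
exists [seq (p@_a, unshifted N a) | a <- msupp p]; split.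
- apply: (mulfI (mono_neq0 (const_mx N%:Z) indep_neq0)).
  rewrite -(mmap_polynomial_of _ indep_neq0 fN) -/p /mmap /lsum big_map mulr_sumr.
  apply: eq_bigr => a _ /=; rewrite mulrCA; congr (_ * _).
  rewrite -monoD; last exact: indep_neq0.
  by rewrite -mono_nat; congr mono; apply/rowP=> i; rewrite !mxE; lia.
- rewrite -map_comp map_inj_uniq ?msupp_uniq // => a b /= /rowP ab.
  by apply/mnmP=> i; have := ab i; rewrite !mxE; lia.
- by move=> x /mapP[a ap ->] /=; rewrite mcoeff_msupp in ap.
- move=> x /mapP[a ap ->] /=.
  have : has (fun z => shifted_monomial N z.2 == a) f.
    apply: contraLR ap => /hasPn nf; rewrite -mcoeff_eq0 /p raddf_sum /=.
    rewrite big_seq big1 // => z zf.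
    by rewrite mcoeffZ mcoeffX (negbTE (nf z zf)) mulr0.
  case/hasP=> z zf /eqP <-; exists z => //.
  by rewrite shifted_monomialK //; apply: fN.
Qed.

End FormalLaurent.

(** * Weights of a torus action *)

Section FieldExtension.
Import mpoly.
Variables (K F G : fieldType) (m : nat).
Variables (iota : {rmorphism K -> F}) (y : 'I_m -> F).
Variables (iota' : {rmorphism K -> G}) (z : 'I_m -> G).
Hypothesis indep : forall p : {mpoly K[m]}, mmap iota y p = 0 -> p = 0.
Hypothesis gen : forall f : F, exists p q : {mpoly K[m]},
  mmap iota y q != 0 /\ f = mmap iota y p / mmap iota y q.
Hypothesis indep' : forall p : {mpoly K[m]}, mmap iota' z p = 0 -> p = 0.

(** F is the fraction field of a polynomial ring, so a morphism to a field is given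
    by algebraically independent images of the variables. *)
Lemma field_extension : exists theta : {rmorphism F -> G},
  (forall c, theta (iota c) = iota' c) /\ (forall i, theta (y i) = z i).
Proof.
pose P f (x : {mpoly K[m]} * {mpoly K[m]}) :=
  (mmap iota y x.2 != 0) && (f == mmap iota y x.1 / mmap iota y x.2).
have exP f : exists x, P f x.
  by have [p [q [q0 ->]]] := gen f; exists (p, q); rewrite /P q0 eqxx.
pose theta f : G := let x := xchoose (exP f) in
  mmap iota' z x.1 / mmap iota' z x.2.
have evM p q : mmap iota y (p * q) = mmap iota y p * mmap iota y q.
  exact: rmorphM.
have evM' p q : mmap iota' z (p * q) = mmap iota' z p * mmap iota' z q.
  exact: rmorphM.
have nz' q : mmap iota y q != 0 -> mmap iota' z q != 0.
  by apply: contra_neq => /indep' ->; rewrite raddf0.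
have thetaE p q : mmap iota y q != 0 ->
    theta (mmap iota y p / mmap iota y q) = mmap iota' z p / mmap iota' z q.
  move=> q0; rewrite /theta.
  have /andP[] := xchooseP (exP (mmap iota y p / mmap iota y q)).
  case: (xchoose _) => [p1 q1] /= q10 /eqP e.
  apply/eqP; rewrite eqr_div ?nz' // -!evM'; apply/eqP; congr mmap.
  apply/eqP; rewrite -subr_eq0; apply/eqP/indep.
  rewrite raddfB /= !evM; apply/eqP; rewrite subr_eq0.
  by rewrite -eqr_div // -e.
have thetaP p : theta (mmap iota y p) = mmap iota' z p.
  by have := @thetaE p 1; rewrite !rmorph1 !divr1 oner_neq0 => ->.
have thB : zmod_morphism theta.
  move=> f g; have [p [q [q0 ->]]] := gen f; have [p1 [q1 [q10 ->]]] := gen g.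
  rewrite -mulNr -raddfN addf_div // -!evM -raddfD /=.
  rewrite !thetaE ?evM ?mulf_neq0 //=.
  by rewrite raddfD /= !evM' raddfN -addf_div ?nz' // mulNr.
have thM : monoid_morphism theta.
  split; first by have := thetaP 1; rewrite !rmorph1.
  move=> f g; have [p [q [q0 ->]]] := gen f; have [p1 [q1 [q10 ->]]] := gen g.
  rewrite mulf_div -!evM !thetaE ?evM ?mulf_neq0 //=.
  by rewrite !evM' mulf_div.
pose tA := GRing.isZmodMorphism.Build F G theta thB.
pose tM := GRing.isMonoidMorphism.Build F G theta thM.
pose T : {rmorphism F -> G} := HB.pack theta tA tM.
exists T; split=> [c|i] /=.
  by have := thetaP c%:MP; rewrite !mmapC.
by have := thetaP 'X_i; rewrite !mmapX !mmap1U.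
Qed.

End FieldExtension.

Local Notation "x %:F" := (@tofrac _ x).

Section TorusAction.
Variables (F : fieldType).
Local Notation W := {fraction {poly F}}.
Implicit Types (f g a b : F) (d e : int) (p q : {poly F}).

Definition tvar : W := ('X)%:F.
Definition emb f : W := (f%:P)%:F.

HB.instance Definition _ := GRing.RMorphism.copy emb (@tofrac _ \o @polyC F).

Lemma tvar_neq0 : tvar != 0.
Proof. by rewrite tofrac_eq0 polyX_eq0. Qed.

Lemma tvarX n : tvar ^+ n = ('X^n)%:F.
Proof. by rewrite /tvar tofracXn. Qed.

Definition coefz p d : F := if d is Posz i then p`_i else 0.

Lemma coefz_mulXn p n d : coefz (p * 'X^n) (d + n%:Z) = coefz p d.
Proof.
case: d => [i|i] /=; first by rewrite coefMXn ltnNge leq_addl /= addnK.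
rewrite NegzE; case: (ltnP i n) => [lt_in|le_ni].
  have -> : - i.+1%:Z + n%:Z = (n - i.+1)%N%:Z by lia.
  by rewrite /= coefMXn; case: ltnP => //; lia.
by have -> : - i.+1%:Z + n%:Z = Negz (i - n) by lia.
Qed.

Lemma coefzD p q d : coefz (p + q) d = coefz p d + coefz q d.
Proof. by case: d => i /=; rewrite ?addr0 // coefD. Qed.

Lemma coefzC a p d : coefz (a%:P * p) d = a * coefz p d.
Proof. by case: d => i /=; rewrite ?mulr0 // coefCM. Qed.

Variable theta : {rmorphism F -> W}.

(** When theta maps y_i to y_i t^(w_i), the elements of weight d are the homogeneous
    rational functions of degree d for the weights w. *)
Definition has_weight d f : Prop := theta f = emb f * tvar ^ d.

Lemma has_weightM d e f g :
  has_weight d f -> has_weight e g -> has_weight (d + e) (f * g).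
Proof.
rewrite /has_weight => hf hg.
by rewrite !rmorphM hf hg expfzDr ?tvar_neq0 // mulrACA.
Qed.

Lemma has_weightV d f : has_weight d f -> has_weight (- d) f^-1.
Proof. by rewrite /has_weight => hf; rewrite !fmorphV hf invfM invr_expz. Qed.

Lemma has_weightXz d f (k : int) : has_weight d f -> has_weight (d * k) (f ^ k).
Proof. by rewrite /has_weight => hf; rewrite !fmorphXz hf expfzMl exprz_exp. Qed.

Lemma has_weightD d f g : has_weight d f -> has_weight d g -> has_weight d (f + g).
Proof. by rewrite /has_weight => hf hg; rewrite !rmorphD hf hg mulrDl. Qed.

Lemma has_weight1 : has_weight 0 1.
Proof. by rewrite /has_weight !rmorph1 expr0z mul1r. Qed.

Lemma has_weight_mono (m : nat) (z : 'I_m -> F) (w : 'I_m -> int) (s : 'rV[int]_m) :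
  (forall i, has_weight (w i) (z i)) ->
  has_weight (\sum_i w i * s 0 i) (mono z s).
Proof.
move=> hz; rewrite /mono.
elim/big_ind2: _ => [|d1 f1 d2 f2|i _]; first exact: has_weight1.
  exact: has_weightM.
exact: has_weightXz.
Qed.

Lemma has_weight_mono_unit (m : nat) (z : 'I_m -> F) (i0 : 'I_m)
    (s : 'rV[int]_m) :
  (forall i, has_weight (i == i0)%:Z (z i)) -> has_weight (s 0 i0) (mono z s).
Proof.
move=> hz; have := has_weight_mono s hz; congr has_weight.
rewrite (bigD1 i0) //= eqxx mul1r big1 ?addr0 // => i /negbTE ->.
exact: mul0r.
Qed.

(** c d is the component of weight d of f: theta f is a Laurent polynomial in t over
    F, whose coefficients are the c d. *)
Definition components f (c : int -> F) : Prop := exists (N : nat) p,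
  theta f * tvar ^+ N = p%:F /\ forall d, c d = coefz p (d + N%:Z).

Lemma components_uniq f c c' : components f c -> components f c' -> c =1 c'.
Proof.
move=> [N [p [fp cE]]] [N' [p' [fp' c'E]]] d; rewrite cE c'E.
have e : p * 'X^N' = p' * 'X^N.
  apply/eqP; rewrite -tofrac_eq !tofracM -!tvarX -fp -fp'.
  by rewrite mulrAC.
by rewrite -(coefz_mulXn p N') e addrAC coefz_mulXn.
Qed.

Lemma components_pad f c N p M : theta f * tvar ^+ N = p%:F ->
  (forall d, c d = coefz p (d + N%:Z)) ->
  theta f * tvar ^+ (N + M) = (p * 'X^M)%:F /\
  forall d, c d = coefz (p * 'X^M) (d + (N + M)%N%:Z).
Proof.
move=> fp cE; split; first by rewrite exprD mulrA fp tofracM tvarX.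
by move=> d; rewrite cE PoszD addrA coefz_mulXn.
Qed.

Lemma componentsD f g c c' : components f c -> components g c' ->
  components (f + g) (fun d => c d + c' d).
Proof.
move=> [N [p [fp cE]]] [N' [p' [fp' c'E]]].
have [{}fp {}cE] := components_pad N' fp cE.
have [{}fp' {}c'E] := components_pad N fp' c'E.
exists (N + N')%N, (p * 'X^N' + p' * 'X^N); split.
  by rewrite rmorphD mulrDl fp addnC fp' tofracD.
by move=> d; rewrite cE c'E coefzD [(N' + N)%N]addnC.
Qed.

Lemma components_weightM e a f c : has_weight e a -> components f c ->
  components (a * f) (fun d => a * c (d - e)).
Proof.
rewrite /has_weight => ha [N [p [fp cE]]].
have [k ek] : exists k : nat, e + `|e|%N%:Z = k%:Z.
  by exists `|(e + `|e|%N%:Z)%R|%N; lia.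
exists (N + `|e|)%N, (a%:P * (p * 'X^k)); split.
  rewrite rmorphM ha !tofracM -tvarX -/(emb a) -fp exprD.
  have <- : tvar ^ (e + `|e|%N%:Z) = tvar ^+ k by rewrite ek.
  rewrite expfzDr ?tvar_neq0 // -exprnP.
  by ring.
move=> d; rewrite cE coefzC; congr (_ * _).
rewrite -(coefz_mulXn p k); congr coefz; rewrite -ek PoszD; ring.
Qed.

Lemma components_bounded f c : components f c ->
  exists B : nat, forall d, (B < `|d|)%N -> c d = 0.
Proof.
move=> [N [p [_ cE]]]; exists (N + size p)%N => d dB; rewrite cE.
case e: (d + N%:Z) => [i|//] /=; rewrite nth_default //;
  move: (size p) dB e => sp; lia.
Qed.

(** The value at 1 recovers f as the sum of its components. *)
Definition graded_dec (V : int -> F -> Prop) f : Prop := exists (N : nat) p,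
  [/\ theta f * tvar ^+ N = p%:F, p.[1] = f & forall i, V (i%:Z - N%:Z) p`_i].

(** The last clause replaces the statement that f is the finite sum of the c d. *)
Lemma graded_dec_components (V : int -> F -> Prop) f :
  (forall d, V d 0) -> graded_dec V f ->
  exists c, [/\ components f c, forall d, V d (c d) &
    forall P : F -> Prop, P 0 -> (forall a b, P a -> P b -> P (a + b)) ->
      (forall d, P (c d)) -> P f].
Proof.
move=> V0 [N [p [fp p1 Vp]]]; exists (fun d => coefz p (d + N%:Z)); split.
- by exists N, p.
- move=> d; case e: (d + N%:Z) => [i|i] //=.
  by have := Vp i; rewrite -e addrK.
- move=> P P0 PD Pc; rewrite -p1 horner_coef.
  elim/big_ind: _ => // i _; rewrite expr1n mulr1.
  by have := Pc (i%:Z - N%:Z); rewrite subrK.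
Qed.

Lemma subalg_graded_dec (K : fieldType) (iota : {rmorphism K -> F})
    (S : F -> Prop) (V : int -> F -> Prop) :
  (forall c, has_weight 0 (iota c)) ->
  (forall d, V d 0) ->
  (forall d a b, V d a -> V d b -> V d (a + b)) ->
  (forall d e a b, V d a -> V e b -> V (d + e) (a * b)) ->
  (forall c, V 0 (iota c)) ->
  (forall x, S x -> exists2 d, V d x & has_weight d x) ->
  forall f, subalg_gen iota S f -> graded_dec V f.
Proof.
move=> hK V0 VD VM VK VS.
have one x d : V d x -> has_weight d x -> graded_dec V x.
  rewrite /has_weight => Vx hx; pose k := `|(d + `|d|%N%:Z)%R|%N.
  have ek : d + `|d|%N%:Z = k%:Z by rewrite /k; lia.
  exists `|d|%N, (x%:P * 'X^k); split.
  - have kE : tvar ^ (d + `|d|%N%:Z) = tvar ^+ k by rewrite ek.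
    rewrite hx tofracM -/(emb x) -tvarX -mulrA -kE.
    by rewrite expfzDr ?tvar_neq0.
  - by rewrite !hornerE expr1n mulr1.
  - move=> i; rewrite coefCM coefXn.
    by have [->|_] := eqVneq i k; rewrite ?mulr0 // mulr1 -ek addrK.
have pad N p M : (forall i, V (i%:Z - N%:Z) p`_i) ->
    forall i, V (i%:Z - (N + M)%N%:Z) (p * 'X^M)`_i.
  move=> Vp i; rewrite coefMXn; case: ltnP => // le_Mi.
  by have -> : i%:Z - (N + M)%N%:Z = (i - M)%N%:Z - N%:Z by lia.
move=> f; elim=> {f} [c|x /VS[d Vx hx]|x1 x2 _ IH1 _ IH2|x1 x2 _ IH1 _ IH2].
- exact: one (VK c) (hK c).
- exact: one Vx hx.
- case: IH1 => N1 [p1 [e1 h1 V1]]; case: IH2 => N2 [p2 [e2 h2 V2]].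
  exists (N1 + N2)%N, (p1 * 'X^N2 + p2 * 'X^N1); split.
  + rewrite rmorphD mulrDl tofracD !tofracM -!tvarX -e1 -e2 exprD; ring.
  + by rewrite !hornerE h1 h2 !expr1n !mulr1.
  + by move=> i; rewrite coefD; apply: VD; [|rewrite addnC]; apply: pad.
- case: IH1 => N1 [p1 [e1 h1 V1]]; case: IH2 => N2 [p2 [e2 h2 V2]].
  exists (N1 + N2)%N, (p1 * p2); split.
  + by rewrite rmorphM tofracM -e1 -e2 exprD mulrACA.
  + by rewrite hornerM h1 h2.
  + move=> i; rewrite coefM; elim/big_ind: _ => // [a b|k _]; first exact: VD.
    have -> : i%:Z - (N1 + N2)%N%:Z =
        (k%:Z - N1%:Z) + ((i - k)%N%:Z - N2%:Z).
      by have := ltn_ord k; lia.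
    exact: VM.
Qed.

End TorusAction.

Section TorusExistence.
Import mpoly.
Variables (K F : fieldType) (iota : {rmorphism K -> F}) (m : nat).
Variable y : 'I_m -> F.
Hypothesis indep : forall p : {mpoly K[m]}, mmap iota y p = 0 -> p = 0.
Hypothesis gen : forall f : F, exists p q : {mpoly K[m]},
  mmap iota y q != 0 /\ f = mmap iota y p / mmap iota y q.

(** The images y_i t^(w_i) are algebraically independent because t = 1 gives back
    the y_i. *)
Lemma torus_action (w : 'I_m -> int) :
  exists theta : {rmorphism F -> {fraction {poly F}}},
    (forall c, has_weight theta 0 (iota c)) /\ (forall i, has_weight theta (w i) (y i)).
Proof.
pose iota' : {rmorphism K -> {fraction {poly F}}} := @emb F \o iota.
pose z i := emb (y i) * tvar F ^ w i.
have indep' p : mmap iota' z p = 0 -> p = 0.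
  move=> p0; apply: indep.
  pose e (a : 'X_{1..m}) : int := \sum_i w i * (a i)%:Z.
  have zE a : mmap1 z a = emb (mmap1 y a) * tvar F ^ e a.
    rewrite /mmap1 rmorph_prod -[tvar F ^ e a]mul1r.
    have -> : tvar F ^ e a = \prod_i tvar F ^ (w i * (a i)%:Z).
      apply: (big_morph (fun d : int => tvar F ^ d)) => [d1 d2|//].
      by rewrite expfzDr ?tvar_neq0.
    rewrite mul1r -big_split /=; apply: eq_bigr => i _.
    by rewrite /z exprMn rmorphXn /= -exprz_exp.
  pose N := (\sum_(a <- msupp p) `|e a|)%N.
  pose k a := `|(e a + N%:Z)%R|%N.
  have kE a : a \in msupp p -> e a + N%:Z = k a.
    move=> ap; rewrite /k; have : (`|e a| <= N)%N.
      by rewrite /N (big_rem a) //= leq_addr.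
    lia.
  have : \sum_(a <- msupp p) (iota p@_a * mmap1 y a)%:P * 'X^(k a) = 0.
    apply/eqP; rewrite -tofrac_eq0; apply/eqP.
    rewrite -[RHS](mul0r (tvar F ^+ N)) -p0 /mmap mulr_suml rmorph_sum /=.
    rewrite big_seq [RHS]big_seq; apply: eq_bigr => a ap.
    rewrite zE tofracM -tvarX -/(emb _) rmorphM /= -!mulrA; congr (_ * (_ * _)).
    have <- : tvar F ^ (e a + N%:Z) = tvar F ^+ k a by rewrite kE.
    by rewrite expfzDr ?tvar_neq0.
  move/(congr1 (fun q : {poly F} => q.[1])); rewrite horner0 horner_sum => h.
  by rewrite -[RHS]h; apply: eq_bigr => a _; rewrite !hornerE expr1n mulr1.
have [theta [thK thy]] := field_extension indep gen indep'.
exists theta; split=> [c|i]; first by rewrite /has_weight thK expr0z mulr1.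
by rewrite /has_weight thy.
Qed.

End TorusExistence.

(** * Mutation of exchange matrices *)

Section ExchangeMatrixMutation.
Variables (n r : nat).
Implicit Types (B : 'M[int]_(n + r, n)) (k : 'I_n).
Local Notation pos z := (Num.max 0 z).

Lemma posN (z : int) : pos (- z) = pos z - z.
Proof. lia. Qed.

Lemma posM (c z : int) : 0 <= c -> pos (c * z) = c * pos z.
Proof. by move=> c0; rewrite maxr_pMr // mulr0. Qed.

(** This form of the mutation rule factors through a row operation and a column
    operation. *)
Lemma mutation_term (a b : int) :
  Num.sg a * pos (a * b) = pos a * b + a * pos (- b).
Proof.
have [a0|a0|->] := ltrgt0P a; last by rewrite sgr0 !mul0r addr0.
- rewrite gtr0_sg // mul1r posM ?ltW // posN; ring.
- rewrite ltr0_sg // -[a * b]mulrNN posM; last by rewrite oppr_ge0 ltW.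
  by rewrite mul0r add0r mulN1r mulNr opprK.
Qed.

Definition skew_data (d : 'I_n -> nat) B : Prop := (forall i, (0 < d i)%N) /\
  forall i j, (d i)%:Z * B (lshift r i) j = - ((d j)%:Z * B (lshift r j) i).

Lemma skew_symmetrizes_data d B : skew_symmetrizes d B -> skew_data d B.
Proof.
case=> d0 sk; split=> // i j; have := congr1 (fun M : 'M[int]_n => M j i) sk.
by rewrite /sym_mx mul_diag_mx !mxE.
Qed.

Lemma skew_data_diag d B i : skew_data d B -> B (lshift r i) i = 0.
Proof. by case=> d0 sk; have := sk i i; have := d0 i; nia. Qed.

Lemma skew_data_sign d B i j : skew_data d B ->
  (0 < B (lshift r i) j) = (B (lshift r j) i < 0).
Proof.
case=> d0 sk; have := sk i j; have := d0 i; have := d0 j => i0 j0 e.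
by apply/idP/idP; nia.
Qed.

Lemma skew_data_eq0 d B i j : skew_data d B ->
  B (lshift r i) j = 0 -> B (lshift r j) i = 0.
Proof. by case=> d0 sk; have := sk i j; have := d0 j; nia. Qed.

Lemma skew_data_mutate d B k : skew_data d B -> skew_data d (mutate_exmx k B).
Proof.
move=> skB; have Bk := skew_data_diag k skB; case: skB => d0 sk.
split=> // i j; rewrite !mxE !(inj_eq (@lshift_inj n r)).
have [->|ik] := eqVneq i k; first by rewrite orbT /= !mulrN sk.
have [->|jk] := eqVneq j k; first by rewrite /= !mulrN sk.
rewrite /= !mutation_term.
have e1 : (d i)%:Z * pos (B (lshift r i) k) =
    (d k)%:Z * pos (- B (lshift r k) i).
  by rewrite -!posM // sk mulrN.
have e2 : (d j)%:Z * pos (B (lshift r j) k) =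
    (d k)%:Z * pos (- B (lshift r k) j).
  by rewrite -!posM // sk mulrN.
have eij := sk i j; have ejk := sk j k.
have -> : (d i)%:Z * (B (lshift r i) j + (pos (B (lshift r i) k) *
      B (lshift r k) j + B (lshift r i) k * pos (- B (lshift r k) j))) =
   - ((d j)%:Z * B (lshift r j) i) +
   ((d k)%:Z * pos (- B (lshift r k) i)) * B (lshift r k) j -
   ((d k)%:Z * B (lshift r k) i) * pos (- B (lshift r k) j).
  by rewrite -e1 -eij (sk k i); ring.
rewrite mulrDr opprD -addrA; congr (_ + _).
rewrite mulrDr !mulrA e2 ejk; ring.
Qed.

Lemma mutate_exmxE B k i j : B (lshift r k) k = 0 ->
  mutate_exmx k B i j =
    if (i == lshift r k) || (j == k) then - B i j
    else B i j + (pos (B i k) * B (lshift r k) j +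
                  B i k * pos (- B (lshift r k) j)).
Proof. by move=> Bk; rewrite mxE mutation_term. Qed.

Lemma mutate_exmxK B k : B (lshift r k) k = 0 ->
  mutate_exmx k (mutate_exmx k B) = B.
Proof.
move=> Bk; apply/matrixP=> i j; rewrite mutate_exmxE; last first.
  by rewrite !mxE eqxx /= Bk oppr0.
rewrite !mutate_exmxE // !eqxx !orbT /=.
case: (_ || _); first by rewrite opprK.
rewrite opprK !posN; ring.
Qed.

(** A left inverse over the rationals, with the denominators cleared. *)
Definition left_invertible B : Prop :=
  exists (O : 'M[int]_(n, n + r)) (c : int), c != 0 /\ O *m B = c%:M.

(** Mutation at k replaces B by E B G with E and G involutions: E = 1 + u e^T adds
    multiples of row k and changes its sign, G = 1 + f^T v does the same for
    columns. *)
Lemma left_invertible_mutate B k : B (lshift r k) k = 0 ->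
  left_invertible B -> left_invertible (mutate_exmx k B).
Proof.
move=> Bk [O [c [c0 OB]]].
pose e : 'cV[int]_(n + r) := delta_mx (lshift r k) 0.
pose u : 'cV[int]_(n + r) := \col_i pos (B i k) - 2%:R *: e.
pose f : 'rV[int]_n := delta_mx 0 k.
pose v : 'rV[int]_n := \row_j pos (- B (lshift r k) j) - 2%:R *: f.
pose E := 1%:M + u *m e^T; pose G := 1%:M + f^T *m v.
have eu : e^T *m u = (-2)%:M.
  apply/matrixP=> i j; rewrite !ord1 trmx_delta -rowE !mxE !eqxx /= Bk.
  by rewrite maxxx.
have vf : v *m f^T = (-2)%:M.
  apply/matrixP=> i j; rewrite !ord1 trmx_delta -colE !mxE !eqxx /= Bk.
  by rewrite oppr0 maxxx.
have EE : E *m E = 1%:M.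
  rewrite /E mulmxDl mul1mx mulmxDr mulmx1 -[(u *m e^T) *m (u *m e^T)]mulmxA.
  rewrite [e^T *m (u *m _)]mulmxA eu mul_scalar_mx -scalemxAr.
  by rewrite -[RHS]addr0 -addrA; congr (_ + _);
    rewrite scaleNr scaler_nat mulr2n addrA subrr.
have GG : G *m G = 1%:M.
  rewrite /G mulmxDl mul1mx mulmxDr mulmx1 -[(f^T *m v) *m (f^T *m v)]mulmxA.
  rewrite [v *m (f^T *m _)]mulmxA vf mul_scalar_mx -scalemxAr.
  by rewrite -[RHS]addr0 -addrA; congr (_ + _);
    rewrite scaleNr scaler_nat mulr2n addrA subrr.
have BE : mutate_exmx k B = E *m B *m G.
  apply/matrixP=> i j; rewrite mutate_exmxE //.
  rewrite /E /G mulmxDl mul1mx mulmxDr mulmx1 mulmxDl -!mulmxA.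
  rewrite [e^T *m (B *m _)]mulmxA.
  have -> : e^T *m B = row (lshift r k) B by rewrite trmx_delta rowE.
  have -> : B *m (f^T *m v) = col k B *m v by rewrite mulmxA trmx_delta colE.
  have -> : row (lshift r k) B *m (f^T *m v) = 0.
    rewrite mulmxA trmx_delta -colE.
    have -> : col k (row (lshift r k) B) = 0 by apply/matrixP=> a b; rewrite !mxE.
    by rewrite mul0mx.
  rewrite mulmx0 addr0 !mxE !big_ord1 !mxE !eqxx /= ?andbT.
  have [->|_] := eqVneq i (lshift r k); have [->|_] := eqVneq j k;
   rewrite /= ?mulr1n ?mulr0n ?Bk ?maxxx ?oppr0 ?maxxx; ring.
exists (G *m O *m E), c; split=> //.
rewrite BE -!mulmxA [E *m (E *m _)]mulmxA EE mul1mx [O *m _]mulmxA OB.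
by rewrite mul_scalar_mx -scalemxAr GG scalemx1.
Qed.

Lemma compatible_left_invertible d B L : (forall i, (0 < d i)%N) ->
  compatible d B L -> left_invertible B.
Proof.
move=> d0 [_ LB]; exists (\adj (sym_mx d) *m usubmx (- L)), (\det (sym_mx d)).
split.
  by rewrite det_diag; apply/prodf_neq0 => i _; rewrite mxE; have := d0 i; lia.
have -> : \adj (sym_mx d) *m usubmx (- L) *m B =
   \adj (sym_mx d) *m usubmx (- L *m B) by rewrite -mulmxA mul_usub_mx.
by rewrite mulNmx LB col_mxKu mul_adj_mx.
Qed.

End ExchangeMatrixMutation.

(** * Mutation of seeds *)

Section SeedMutation.
Import mpoly.
Variables (K F : fieldType) (iota : {rmorphism K -> F}) (n r : nat).
Hypothesis charK : [pchar K] =i pred0.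
Implicit Types (t : seed F n r) (k : 'I_n).
Local Notation pos z := (Num.max 0 z).
Local Notation indep y :=
  (forall p : {mpoly K[n + r]}, mmap iota y p = 0 -> p = 0).

Lemma pcharF : [pchar F] =i pred0.
Proof. by move=> p; rewrite (fmorph_pchar iota) charK. Qed.

Lemma natF_eq0 (j : nat) : (j%:R == 0 :> F) = (j == 0)%N.
Proof. exact: (proj1 (pcharf0P F) pcharF). Qed.

Definition pos_exponents (B : 'M[int]_(n + r, n)) k : 'rV[int]_(n + r) :=
  \row_i pos (B i k).

Definition exchange_poly (y : 'I_(n + r) -> F) B k : F :=
  mono y (pos_exponents B k) + mono y (pos_exponents (- B) k).

(** What the proof of the Laurent phenomenon uses about a seed; all of it is
    inherited by mutated seeds. *)
Record good_seed t : Prop := GoodSeed {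
  good_indep : indep (cvar t);
  good_gen : forall f : F, exists p q : {mpoly K[n + r]},
    mmap iota (cvar t) q != 0 /\ f = mmap iota (cvar t) p / mmap iota (cvar t) q;
  good_skew : exists d, skew_data d (exmx t);
  good_left_inv : left_invertible (exmx t) }.

Lemma good_neq0 t i : good_seed t -> cvar t i != 0.
Proof. by case=> h _ _ _; apply: (indep_neq0 h). Qed.

Lemma good_diag t k : good_seed t -> exmx t (lshift r k) k = 0.
Proof. by case=> _ _ [d sk] _; apply: skew_data_diag sk. Qed.

Lemma cvar_mutate_other t k i : i != lshift r k ->
  cvar (mutate_seed k t) i = cvar t i.
Proof. by move=> ik; rewrite ffunE (negbTE ik). Qed.

Lemma cvar_mutate t k : cvar (mutate_seed k t) (lshift r k) =
  exchange_poly (cvar t) (exmx t) k / cvar t (lshift r k).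
Proof.
rewrite ffunE eqxx /exchange_poly /mono; congr ((_ + _) / _).
  by apply: eq_bigr => i _; rewrite mxE.
by apply: eq_bigr => i _; rewrite !mxE.
Qed.

Lemma mono_mutate t k (s : 'rV[int]_(n + r)) : s 0 (lshift r k) = 0 ->
  mono (cvar (mutate_seed k t)) s = mono (cvar t) s.
Proof.
move=> s0; apply: eq_bigr => i _.
have [->|ik] := eqVneq i (lshift r k); first by rewrite s0 !expr0z.
by rewrite cvar_mutate_other.
Qed.

Lemma pos_exponents_diag t k : good_seed t ->
  pos_exponents (exmx t) k 0 (lshift r k) = 0 /\
  pos_exponents (- exmx t) k 0 (lshift r k) = 0.
Proof. by move=> gt; rewrite !mxE good_diag // oppr0 maxxx. Qed.

Lemma exchange_poly_mutate t k : good_seed t ->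
  exchange_poly (cvar (mutate_seed k t)) (exmx (mutate_seed k t)) k =
  exchange_poly (cvar t) (exmx t) k.
Proof.
move=> gt; have [p0 n0] := pos_exponents_diag k gt.
have e1 : pos_exponents (exmx (mutate_seed k t)) k = pos_exponents (- exmx t) k.
  by apply/rowP=> i; rewrite !mxE eqxx orbT.
have e2 : pos_exponents (- exmx (mutate_seed k t)) k = pos_exponents (exmx t) k.
  by apply/rowP=> i; rewrite !mxE eqxx orbT opprK.
by rewrite /exchange_poly e1 e2 !mono_mutate // addrC.
Qed.

(** A sum of two monomials vanishes only in characteristic 2. *)
Lemma exchange_poly_neq0 (y : 'I_(n + r) -> F) B k :
  indep y -> exchange_poly y B k != 0.
Proof.
move=> ind.
pose a : 'X_{1..n + r} := [multinom absz (pos_exponents B k 0%R i) | i < n + r].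
pose b : 'X_{1..n + r} := [multinom absz (pos_exponents (- B) k 0%R i) | i < n + r].
have -> : exchange_poly y B k = mmap iota y ('X_[a] + 'X_[b]).
  rewrite raddfD /= !mmapX -!mono_nat; congr (mono y _ + mono y _);
    by apply/rowP=> i; rewrite !mxE mnmE !mxE gez0_abs // le_max lexx.
apply/negP=> /eqP/ind/(congr1 (mcoeff a)) /eqP.
rewrite mcoeffD !mcoeffX eqxx mcoeff0 -natrD.
by rewrite (proj1 (pcharf0P K) charK).
Qed.

Lemma mutate_seedK t k : good_seed t -> mutate_seed k (mutate_seed k t) = t.
Proof.
move=> gt; case E : (mutate_seed k (mutate_seed k t)) => [y B].
have -> : B = exmx t.
  by have := congr1 (fun s => exmx s) E; rewrite /= mutate_exmxK ?good_diag.
have -> : y = cvar t.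
  rewrite -[y]/(cvar (Seed y B)) -E; apply/ffunP=> i.
  have [->|ik] := eqVneq i (lshift r k); last by rewrite !cvar_mutate_other.
  rewrite cvar_mutate exchange_poly_mutate // cvar_mutate invfM invrK mulVKf //.
  by apply: exchange_poly_neq0; apply: good_indep gt.
by case: t {gt E}.
Qed.

(** Give y_k weight 1 and the other variables weight 0: a polynomial relation between
    the mutated variables splits into its homogeneous parts, and each part is a
    power of y_k' / y_k times a relation between the old variables. *)
Lemma indep_mutate t k : good_seed t -> indep (cvar (mutate_seed k t)).
Proof.
move=> gt p p0; have [p0k n0k] := pos_exponents_diag k gt.
set y' := cvar _ in p0 *; pose y := cvar t; pose i0 := lshift r k.
have nz i : y i != 0 by exact: good_neq0.
have Enz : exchange_poly y (exmx t) k != 0.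
  by apply: exchange_poly_neq0; apply: good_indep gt.
pose c := y' i0 / y i0.
have c0 : c != 0 by rewrite /c /y' cvar_mutate !mulf_neq0 ?invr_neq0.
have y'E a : mmap1 y' a = mmap1 y a * c ^+ a i0.
  rewrite /mmap1 (bigD1 i0) //= [in RHS](bigD1 i0) //= mulrAC; congr (_ * _).
    by rewrite -exprMn /c mulrC divfK.
  by apply: eq_bigr => i ik; rewrite /y' cvar_mutate_other.
have [theta [hK hy]] :=
  torus_action (good_indep gt) (good_gen gt) (fun i => (i == i0)%:Z).
have hmono (s : 'rV[int]_(n + r)) : s 0 i0 = 0 -> has_weight theta 0 (mono y s).
  by move=> <-; apply: has_weight_mono_unit.
have hy0 : has_weight theta 1 (y i0) by have := hy i0; rewrite eqxx.
have hy' (a : 'X_{1..n + r}) : has_weight theta (- (a i0)%:Z) (mmap1 y' a).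
  have hE : has_weight theta 0 (exchange_poly y (exmx t) k).
    by apply: has_weightD; apply: hmono.
  have hc : has_weight theta (-2%:Z) c.
    have -> : -2%:Z = (0 + - 1) + - 1 :> int by [].
    rewrite /c /y' cvar_mutate; apply: has_weightM; last exact: has_weightV.
    by apply: has_weightM => //; apply: has_weightV.
  have ha : has_weight theta (a i0)%:Z (mmap1 y a).
    have := has_weight_mono_unit (\row_i (a i)%:Z) hy.
    by rewrite mono_nat mxE.
  rewrite y'E; have := has_weightM ha (has_weightXz (a i0)%:Z hc).
  by congr has_weight; lia.
pose N := (\sum_(a <- msupp p) a i0)%N.
have aN a : a \in msupp p -> (a i0 <= N)%N.
  by move=> ap; rewrite /N (big_rem a) //= leq_addr.
have : \sum_(a <- msupp p) (iota p@_a * mmap1 y' a)%:P * 'X^(N - a i0) = 0.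
  apply/eqP; rewrite -tofrac_eq0; apply/eqP.
  transitivity (theta (mmap iota y' p) * tvar F ^+ N); last first.
    by rewrite p0 rmorph0 mul0r.
  rewrite rmorph_sum /= /mmap rmorph_sum mulr_suml /=.
  rewrite big_seq [RHS]big_seq; apply: eq_bigr => a ap.
  rewrite tofracM -tvarX -/(emb _) !rmorphM /= (hK _) (hy' _) expr0z mulr1.
  rewrite -!mulrA; congr (_ * (_ * _)).
  have -> : tvar F ^+ N = tvar F ^ ((a i0)%:Z + (N - a i0)%N%:Z).
    by rewrite -PoszD subnKC // aN.
  by rewrite expfzDr ?tvar_neq0 // mulrA -expfzDr ?tvar_neq0 // addNr expr0z mul1r.
move=> poly0; apply/mpolyP=> a; rewrite mcoeff0.
have [ap|] := boolP (a \in msupp p); last exact: memN_msupp_eq0.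
pose q := \sum_(b <- msupp p | b i0 == a i0) p@_b *: 'X_[b].
have q0 : q = 0.
  apply: (good_indep gt).
  have := congr1 (fun P : {poly F} => P`_(N - a i0)) poly0.
  rewrite coef0 coef_sum => sum0.
  apply: (mulfI (expf_neq0 (a i0) c0)); rewrite mulr0 -[RHS]sum0 raddf_sum /=.
  rewrite mulr_sumr big_mkcond /= big_seq [RHS]big_seq; apply: eq_bigr => b bp.
  rewrite coefCM coefXn.
  have -> : (N - a i0 == N - b i0)%N = (b i0 == a i0).
    by have := aN _ ap; have := aN _ bp; lia.
  case: eqP => [e|_]; last by rewrite mulr0.
  by rewrite mmapZ mmapX y'E mulr1 e mulrC mulrA.
have := congr1 (mcoeff a) q0; rewrite mcoeff0 raddf_sum /= => <-.
rewrite big_mkcond (bigD1_seq a) ?msupp_uniq //= eqxx mcoeffZ mcoeffX eqxx mulr1.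
rewrite big1 ?addr0 // => b ba; case: eqP => // _.
by rewrite mcoeffZ mcoeffX (negbTE ba) mulr0.
Qed.

(** The rational functions in the mutated variables form a field that contains y_k,
    because the exchange relation is symmetric. *)
Lemma gen_mutate t k : good_seed t ->
  forall f : F, exists p q : {mpoly K[n + r]},
    mmap iota (cvar (mutate_seed k t)) q != 0 /\
    f = mmap iota (cvar (mutate_seed k t)) p / mmap iota (cvar (mutate_seed k t)) q.
Proof.
move=> gt; have [p0k n0k] := pos_exponents_diag k gt.
set y' := cvar _; pose D f := exists p q : {mpoly K[n + r]},
  mmap iota y' q != 0 /\ f = mmap iota y' p / mmap iota y' q.
have Dpoly p : D (mmap iota y' p).
  by exists p, 1; rewrite rmorph1 oner_neq0 divr1.
have DK c : D (iota c) by rewrite -(mmapC y'); apply: Dpoly.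
have DD f g : D f -> D g -> D (f + g).
  move=> [p [q [q0 ->]]] [p1 [q1 [q10 ->]]].
  exists (p * q1 + p1 * q), (q * q1).
  by rewrite rmorphD !rmorphM mulf_neq0 // addf_div.
have DM f g : D f -> D g -> D (f * g).
  move=> [p [q [q0 ->]]] [p1 [q1 [q10 ->]]].
  by exists (p * p1), (q * q1); rewrite !rmorphM mulf_neq0 // mulf_div.
have DV f : D f -> D f^-1.
  move=> [p [q [q0 ->]]]; rewrite invf_div.
  have [->|pn0] := eqVneq (mmap iota y' p) 0; last by exists q, p.
  by rewrite invr0 mulr0 -(rmorph0 (mmap iota y')); apply: Dpoly.
have D1 : D 1 by rewrite -(rmorph1 iota).
have DX f (j : nat) : D f -> D (f ^+ j).
  by move=> Df; elim: j => [|j IH]; rewrite ?expr0 // exprS; apply: DM.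
have DXz f (z : int) : D f -> D (f ^ z).
  by move=> Df; case: z => j; rewrite ?NegzE ?exprnN; [|apply: DV]; apply: DX.
have Dy' i : D (y' i).
  by have := Dpoly 'X_i; rewrite mmapX mmap1U.
have Dmono (s : 'rV[int]_(n + r)) : D (mono y' s).
  by rewrite /mono; apply: (big_ind D) => // i _; apply: DXz.
have Dy i : D (cvar t i).
  have [->|ik] := eqVneq i (lshift r k); last first.
    by rewrite -(cvar_mutate_other t ik).
  have -> : cvar t (lshift r k) = exchange_poly (cvar t) (exmx t) k / y' (lshift r k).
    rewrite /y' cvar_mutate invfM invrK mulVKf //.
    by apply: exchange_poly_neq0; apply: good_indep gt.
  rewrite -(exchange_poly_mutate k gt); apply: DM; last exact: DV.
  by apply: DD; apply: Dmono.
have Dp p : D (mmap iota (cvar t) p).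
  have D0 : D 0 by rewrite -(rmorph0 iota); apply: DK.
  rewrite /mmap; apply: (big_ind D) => // a _; apply: (DM) => //.
  by rewrite /mmap1; apply: (big_ind D) => // i _; apply: DX.
by move=> f; have [p [q [_ ->]]] := good_gen gt f; apply/DM/DV.
Qed.

Lemma good_mutate t k : good_seed t -> good_seed (mutate_seed k t).
Proof.
move=> gt; split.
- exact: indep_mutate.
- exact: gen_mutate.
- by have [d sk] := good_skew gt; exists d; apply: skew_data_mutate.
- by apply: left_invertible_mutate (good_left_inv gt); apply: good_diag.
Qed.

Lemma good_mut_equiv t s : good_seed t -> mut_equiv t s -> good_seed s.
Proof. by move=> gt; elim=> // k u _ gu; apply: good_mutate. Qed.

End SeedMutation.

(** * The Laurent phenomenon *)

Section Subalgebras.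
Variables (K F : fieldType) (iota : {rmorphism K -> F}).
Implicit Types (S : F -> Prop) (x y : F).

Lemma subalg1 S : subalg_gen iota S 1.
Proof. by rewrite -(rmorph1 iota); apply: subalg_scalar. Qed.

Lemma subalg0 S : subalg_gen iota S 0.
Proof. by rewrite -(rmorph0 iota); apply: subalg_scalar. Qed.

Lemma subalgN S x : subalg_gen iota S x -> subalg_gen iota S (- x).
Proof.
rewrite -mulN1r -(rmorph1 iota) -rmorphN => Sx.
by apply: subalg_mul => //; apply: subalg_scalar.
Qed.

Lemma subalgB S x y :
  subalg_gen iota S x -> subalg_gen iota S y -> subalg_gen iota S (x - y).
Proof. by move=> Sx Sy; apply: subalg_add => //; apply: subalgN. Qed.

Lemma subalgX S x j : subalg_gen iota S x -> subalg_gen iota S (x ^+ j).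
Proof.
move=> Sx; elim: j => [|j IH]; first by rewrite expr0; apply: subalg1.
by rewrite exprS; apply: subalg_mul.
Qed.

Lemma subalg_sum S (I : Type) (s : seq I) (P : pred I) (f : I -> F) :
  (forall i, P i -> subalg_gen iota S (f i)) ->
  subalg_gen iota S (\sum_(i <- s | P i) f i).
Proof.
move=> Sf; elim/big_ind: _ => //; first exact: subalg0.
by move=> x y; apply: subalg_add.
Qed.

Lemma subalg_sub S S' x : (forall z, S z -> subalg_gen iota S' z) ->
  subalg_gen iota S x -> subalg_gen iota S' x.
Proof.
move=> SS'; elim=> [c|z /SS'//|z z' _ Hz _ Hz'|z z' _ Hz _ Hz'].
- exact: subalg_scalar.
- exact: subalg_add.
- exact: subalg_mul.
Qed.

Lemma subalgXz S x (z : int) : (0 <= z -> subalg_gen iota S x) ->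
  (z < 0 -> subalg_gen iota S x^-1) -> subalg_gen iota S (x ^ z).
Proof.
case: z => j S1 S2; first by apply: subalgX; apply: S1.
by rewrite NegzE -exprnN -exprVn; apply: subalgX; apply: S2.
Qed.

Lemma subalg_mono S (m : nat) (z : 'I_m -> F) (s : 'rV[int]_m) :
  (forall i, 0 < s 0 i -> subalg_gen iota S (z i)) ->
  (forall i, s 0 i < 0 -> subalg_gen iota S (z i)^-1) ->
  subalg_gen iota S (mono z s).
Proof.
move=> S1 S2; rewrite /mono; elim/big_ind: _ => [|x y|i _].
- exact: subalg1.
- exact: subalg_mul.
have [si|si|->] := ltrgt0P (s 0 i); last by rewrite expr0z; apply: subalg1.
  by apply: subalgXz => h; [apply: S1|lia].
by apply: subalgXz => h; [lia|apply: S2].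
Qed.

(** Homogeneous generators that lie in a graded family V force the components of all
    elements of the subalgebra into V. *)
Lemma subalg_components S (V : int -> F -> Prop)
    (theta : {rmorphism F -> {fraction {poly F}}}) :
  (forall c, has_weight theta 0 (iota c)) ->
  (forall d, V d 0) ->
  (forall d a b, V d a -> V d b -> V d (a + b)) ->
  (forall d e a b, V d a -> V e b -> V (d + e) (a * b)) ->
  (forall c, V 0 (iota c)) ->
  (forall x, S x -> exists2 d, V d x & has_weight theta d x) ->
  forall f, subalg_gen iota S f ->
  exists c, [/\ components theta f c, forall d, V d (c d) &
    forall P : F -> Prop, P 0 -> (forall a b, P a -> P b -> P (a + b)) ->
      (forall d, P (c d)) -> P f].
Proof.
move=> hK V0 VD VM VK VS f Sf; apply: graded_dec_components => //.
exact: subalg_graded_dec hK V0 VD VM VK VS f Sf.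
Qed.

End Subalgebras.

Section ExchangeRelation.
Variables (K F : fieldType) (iota : {rmorphism K -> F}) (m : nat).
Local Notation pos z := (Num.max 0 z).
Implicit Types (v s : 'rV[int]_m) (y : 'I_m -> F).

Definition pos_part v : 'rV[int]_m := \row_i pos (v 0 i).

Definition binomial_of y v : F := mono y (pos_part v) + mono y (pos_part (- v)).

Lemma binomial_ofN y v : binomial_of y (- v) = binomial_of y v.
Proof. by rewrite /binomial_of opprK addrC. Qed.

(** The only computation behind the Laurent phenomenon.  Here y' is the seed y
    mutated at k, and a, a' are the columns of j before and after, so that the
    two quotients are the mutations of y_j from y and from y'.  Since
    y_k = Q / y'_k with Q = mono al + mono be, and be contains y_j, replacing Q by
    mono al changes the binomial of a by a multiple of y_j; after that
    replacement it is a monomial times the binomial of a'. *)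
Lemma exchange_relation_change (S : F -> Prop) (y y' : 'I_m -> F) (j k : 'I_m)
    (a e a' : 'rV[int]_m) :
  (forall i, y i != 0) -> (forall i, y' i != 0) ->
  (forall i, i != k -> y' i = y i) ->
  y k * y' k = binomial_of y e ->
  j != k -> a 0 j = 0 -> e 0 k = 0 -> e 0 j < 0 -> 0 < a 0 k ->
  a' 0 k = - a 0 k ->
  (forall i, i != k -> a' 0 i = a 0 i + a 0 k * pos (e 0 i)) ->
  (forall s, 0 <= s 0 j -> subalg_gen iota S (mono y' s)) ->
  subalg_gen iota S (binomial_of y' a' / y j) ->
  subalg_gen iota S (binomial_of y a / y j).
Proof.
move=> ynz y'nz yy' Qk jk aj ek ej ak a'k a'i Smono Sx''.
have [b bE] : exists b : nat, a 0 k = b%:Z by exists (absz (a 0 k)%R); lia.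
have monoE s : s 0 k = 0 -> mono y' s = mono y s.
  move=> sk; apply: eq_bigr => i _.
  by have [->|ik] := eqVneq i k; rewrite ?sk ?expr0z // yy'.
pose dk : 'rV[int]_m := delta_mx 0 k; pose dj : 'rV[int]_m := delta_mx 0 j.
pose p0 := pos_part a - b%:Z *: dk.
pose q := pos_part (- a).
pose al := pos_part e; pose be := pos_part (- e).
(* The monomial of exponent sg is the ratio of the two binomials modulo y_j. *)
pose sg := p0 + b%:Z *: al - b%:Z *: dk - pos_part a'.
have jk' : (j == k) = false by apply/negbTE.
have eq1 : pos_part a' + sg = p0 + b%:Z *: al - b%:Z *: dk.
  by rewrite /sg addrC subrK.
have eq2 : pos_part (- a') + sg = q.
  apply/rowP=> i; rewrite !mxE eqxx /=.
  have [->|ik] := eqVneq i k; first by rewrite a'k bE ek maxxx; lia.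
  rewrite a'i // bE; move: (a 0 i) (e 0 i) => A B; lia.
have Sq : mono y q = mono y' q.
  by rewrite monoE // !mxE bE; lia.
have Sp0 : mono y p0 = mono y' p0.
  by rewrite monoE // !mxE bE !eqxx; lia.
have Sal : mono y al = mono y' al by rewrite monoE // !mxE ek maxxx.
have Sbe : mono y be = mono y' be by rewrite monoE // !mxE ek oppr0 maxxx.
have monoX (w : 'rV[int]_m) : mono y' (b%:Z *: w) = mono y' w ^+ b.
  rewrite /mono -prodrXl; apply: eq_bigr => i _.
  by rewrite mxE mulrC -exprz_exp.
have y'j : y' j = y j by rewrite yy'.
have yj0 := ynz j; have y'k0 := y'nz k.
have E1 : binomial_of y a =
    mono y' p0 * (mono y' al + mono y' be) ^+ b / y' k ^+ b + mono y' q.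
  have yk : y k = (mono y' al + mono y' be) / y' k.
    by rewrite -Sal -Sbe -/(binomial_of y e) -Qk mulfK.
  have pE : pos_part a = p0 + b%:Z *: dk by rewrite /p0 subrK.
  rewrite /binomial_of -/q pE monoD // Sp0 Sq -mulrA -expr_div_n -yk.
  congr (_ * _ + _).
  rewrite /mono (bigD1 k) //= !mxE !eqxx mulr1 big1 ?mulr1 // => i ik.
  by rewrite !mxE (negbTE ik) andbF mulr0 expr0z.
have E2 : mono y' sg * binomial_of y' a' =
    mono y' p0 * mono y' al ^+ b / y' k ^+ b + mono y' q.
  rewrite /binomial_of mulrDr ![mono y' sg * _]mulrC -!monoD // eq1 eq2.
  by rewrite monoD // monoN // !monoX monoD // monoX mono_delta.
have -> : binomial_of y a / y j = mono y' sg * (binomial_of y' a' / y j) +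
    mono y' (p0 - b%:Z *: dk + be - dj) *
    (\sum_(i < b) (mono y' al + mono y' be) ^+ (b.-1 - i) * mono y' al ^+ i).
  rewrite (_ : mono y' (p0 - _ + be - dj) =
      mono y' p0 / y' k ^+ b * mono y' be / y j); last first.
    by rewrite !monoD // !monoN // monoX !mono_delta y'j.
  set X := mono y' al in E1 E2 *; set Z := mono y' be in E1 E2 *.
  have hX : (X + Z) ^+ b = X ^+ b + Z * \sum_(i < b) (X + Z) ^+ (b.-1 - i) * X ^+ i.
    have := subrXX (X + Z) X b; rewrite [X + Z - X]addrAC subrr add0r => <-.
    by rewrite [RHS]addrC subrK.
  rewrite E1 hX [mono y' sg * _]mulrA E2.
  by field; rewrite yj0 expf_neq0.
have Sal' : subalg_gen iota S (mono y' al) by apply: Smono; rewrite !mxE; lia.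
have Sbe' : subalg_gen iota S (mono y' be) by apply: Smono; rewrite !mxE; lia.
apply: subalg_add.
  by apply: subalg_mul => //; apply: Smono; rewrite !mxE a'i // jk' /= aj; lia.
apply: subalg_mul; first by apply: Smono; rewrite !mxE eqxx jk' /= aj; lia.
apply: subalg_sum => i _.
by apply: subalg_mul; apply: subalgX => //; apply: subalg_add.
Qed.

End ExchangeRelation.

Section LaurentPhenomenon.
Variables (K F : fieldType) (iota : {rmorphism K -> F}) (n r : nat).
Hypothesis charK : [pchar K] =i pred0.
Implicit Types (t s : seed F n r) (j k : 'I_n).
Local Notation pos z := (Num.max 0 z).
Local Notation good := (good_seed iota).
Local Notation Lau t := (laurent_ring iota t).

Lemma exchange_polyE (y : 'I_(n + r) -> F) B k :
  exchange_poly y B k = binomial_of y (\row_i B i k).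
Proof. by congr (mono y _ + mono y _); apply/rowP=> i; rewrite !mxE. Qed.

Lemma laurent_var t i : Lau t (cvar t i).
Proof. by apply: subalg_in; exists i; left. Qed.

Lemma laurent_varV t i : Lau t (cvar t i)^-1.
Proof. by apply: subalg_in; exists i; right. Qed.

Lemma laurent_mono t (s : 'rV[int]_(n + r)) : Lau t (mono (cvar t) s).
Proof.
by apply: subalg_mono => i _; [apply: laurent_var|apply: laurent_varV].
Qed.

Lemma laurent_exchange_poly t B k : Lau t (exchange_poly (cvar t) B k).
Proof. by apply: subalg_add; apply: laurent_mono. Qed.

Lemma laurent_mutated_var t k i : Lau t (cvar (mutate_seed k t) i).
Proof.
have [->|ik] := eqVneq i (lshift r k).
  rewrite cvar_mutate; apply: subalg_mul; last exact: laurent_varV.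
  exact: laurent_exchange_poly.
by rewrite cvar_mutate_other //; apply: laurent_var.
Qed.

Lemma laurent_var_mutate t k i : good t -> Lau (mutate_seed k t) (cvar t i).
Proof.
by move=> gt; have := laurent_mutated_var (mutate_seed k t) k i;
  rewrite (mutate_seedK charK k gt).
Qed.

Lemma laurent_mono_mutate t k (s : 'rV[int]_(n + r)) : good t ->
  0 <= s 0 (lshift r k) -> Lau (mutate_seed k t) (mono (cvar t) s).
Proof.
move=> gt sk; apply: subalg_mono => i si; first exact: laurent_var_mutate.
have ik : i != lshift r k by apply: contraTneq si => ->; rewrite -leNgt.
by rewrite -(cvar_mutate_other t ik); apply: laurent_varV.
Qed.

(** When the weights annihilate the k-th column of the exchange matrix, both terms of
    the exchange relation have the same weight. *)
Lemma has_weight_mutate (theta : {rmorphism F -> {fraction {poly F}}})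
    (w : 'I_(n + r) -> int) t k :
  (forall i, has_weight theta (w i) (cvar t i)) ->
  \sum_i w i * exmx t i k = 0 ->
  forall i, exists d, has_weight theta d (cvar (mutate_seed k t) i).
Proof.
move=> hw bal i; have [->|ik] := eqVneq i (lshift r k); last first.
  by exists (w i); rewrite cvar_mutate_other.
exists (\sum_i w i * pos_exponents (exmx t) k 0 i - w (lshift r k)).
rewrite cvar_mutate; apply: has_weightM; last exact: has_weightV.
apply: has_weightD; first exact: has_weight_mono.
have -> : \sum_i w i * pos_exponents (exmx t) k 0 i =
    \sum_i w i * pos_exponents (- exmx t) k 0 i.
  apply/eqP; rewrite -subr_eq0 -sumrB -[X in _ == X]bal; apply/eqP.
  by apply: eq_bigr => l _; rewrite -mulrBr !mxE posN; congr (_ * _); ring.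
exact: has_weight_mono.
Qed.

Definition exchange_ring t j : F -> Prop := subalg_gen iota (fun x =>
  [\/ x = cvar t (lshift r j), x = cvar (mutate_seed j t) (lshift r j) |
      exists2 i, i != lshift r j & x = cvar t i \/ x = (cvar t i)^-1]).

(** Grade by the exponent of y_j; its mutation is homogeneous of weight -1.  A
    component of weight d is a multiple of the d-th power of y_j by Laurentness
    in t, and of the (-d)-th power of the mutated variable by Laurentness in
    mu_j t; use the one with a nonnegative exponent. *)
Lemma laurent_inter_exchange_ring t j f : good t ->
  Lau t f -> Lau (mutate_seed j t) f -> exchange_ring t j f.
Proof.
move=> gt Lf L'f; pose i0 := lshift r j.
have nz i : cvar t i != 0 by exact: (good_neq0 (iota := iota)).
have nz' : cvar (mutate_seed j t) i0 != 0.
  by apply: (good_neq0 (iota := iota)); apply: good_mutate.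
pose S0 x := exists2 i, i != i0 & x = cvar t i \/ x = (cvar t i)^-1.
pose R0 := subalg_gen iota S0.
pose V z (d : int) x := exists2 c, R0 c & x = c * z ^ d.
have V0 z d : V z d 0 by exists 0; rewrite ?mul0r //; apply: subalg0.
have VD z d a b : V z d a -> V z d b -> V z d (a + b).
  move=> [c Rc ->] [c' Rc' ->]; exists (c + c'); rewrite ?mulrDl //.
  exact: subalg_add.
have VM z : z != 0 -> forall d e a b, V z d a -> V z e b -> V z (d + e) (a * b).
  move=> z0 d e a b [c Rc ->] [c' Rc' ->]; exists (c * c').
    exact: subalg_mul.
  by rewrite expfzDr // mulrACA.
have VK z c : V z 0 (iota c).
  by exists (iota c); rewrite ?expr0z ?mulr1 //; apply: subalg_scalar.
have Vself z : V z 1 z by exists 1; rewrite ?expr1z ?mul1r //; apply: subalg1.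
have VselfV z : V z (-1) z^-1.
  by exists 1; rewrite ?mul1r ?exprN1 //; apply: subalg1.
have Vother z i : i != i0 -> V z 0 (cvar t i) /\ V z 0 (cvar t i)^-1.
  by move=> ii; split; [exists (cvar t i)|exists (cvar t i)^-1];
    rewrite ?expr0z ?mulr1 //; apply: subalg_in; exists i => //; [left|right].
have [theta [hK hy]] :=
  torus_action (good_indep gt) (good_gen gt) (fun i => (i == i0)%:Z).
have hy1 : has_weight theta 1 (cvar t i0) by have := hy i0; rewrite eqxx.
have hy0 i : i != i0 -> has_weight theta 0 (cvar t i).
  by move=> /negbTE ii; have := hy i; rewrite ii.
have hy' : has_weight theta (- 1) (cvar (mutate_seed j t) i0).
  have [p0 n0] := pos_exponents_diag j gt.
  rewrite cvar_mutate -[X in has_weight _ X _]add0r.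
  apply: has_weightM; last exact: has_weightV.
  apply: has_weightD.
    by rewrite -[X in has_weight _ X _]p0; apply: has_weight_mono_unit.
  by rewrite -[X in has_weight _ X _]n0; apply: has_weight_mono_unit.
have [c [fc Vc Pc]] : exists c, [/\ components theta f c,
    forall d, V (cvar t i0) d (c d) &
    forall P : F -> Prop, P 0 -> (forall a b, P a -> P b -> P (a + b)) ->
      (forall d, P (c d)) -> P f].
  apply: subalg_components Lf => //; [exact: VD|exact: VM (nz i0)|].
  move=> x [i]; have [->|ii] := eqVneq i i0; case=> ->.
  - by exists 1.
  - by exists (-1); last exact: has_weightV.
  - by exists 0; [have [] := Vother (cvar t i0) i ii|exact: hy0].
  - by exists 0; [have [] := Vother (cvar t i0) i ii|apply: has_weightV (hy0 i ii)].
have [c' [fc' Vc' _]] : exists c, [/\ components theta f c,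
    forall d, V (cvar (mutate_seed j t) i0)^-1 d (c d) &
    forall P : F -> Prop, P 0 -> (forall a b, P a -> P b -> P (a + b)) ->
      (forall d, P (c d)) -> P f].
  apply: subalg_components L'f => //; [exact: VD|by apply: VM; rewrite invr_neq0|].
  move=> x [i]; have [->|ii] := eqVneq i i0; case=> ->.
  - by exists (-1) => //; have := VselfV (cvar (mutate_seed j t) i0)^-1;
    rewrite invrK.
  - by exists 1 => //; exact: has_weightV hy'.
  - rewrite (cvar_mutate_other t ii).
    by exists 0; [have [] := Vother (cvar (mutate_seed j t) i0)^-1 i ii|exact: hy0].
  - rewrite (cvar_mutate_other t ii).
    by exists 0;
      [have [] := Vother (cvar (mutate_seed j t) i0)^-1 i ii|apply: has_weightV (hy0 i ii)].
have RE x : R0 x -> exchange_ring t j x.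
  by apply: subalg_sub => z Sz; apply: subalg_in; apply: Or33.
apply: Pc => [|a b|d]; [exact: subalg0|exact: subalg_add|].
case: (lerP 0 d) => d0.
  have [a Ra ->] := Vc d; apply: subalg_mul; first exact: RE.
  by apply: subalgXz; [move=> _; apply: subalg_in; apply: Or31|rewrite ltNge d0].
rewrite (components_uniq fc fc'); have [a Ra ->] := Vc' d.
apply: subalg_mul; first exact: RE.
rewrite exprz_inv; apply: subalgXz; last by rewrite oppr_lt0 ltNge ltW.
by move=> _; apply: subalg_in; apply: Or32.
Qed.

(** In weight d + eu, the product (u + o) f has component u c_d + o c_(d + eu - eo).
    Starting from the vanishing components far away in the direction of
    eu - eo, this puts all the c_d in A one after the other. *)
Lemma cancel_binomial (theta : {rmorphism F -> {fraction {poly F}}})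
    (A : F -> Prop) (eu eo : int) (u o : F) (c c' : int -> F) f :
  A 0 -> (forall a b, A a -> A b -> A (a - b)) ->
  (forall a b, A a -> A b -> A (a * b)) ->
  u != 0 -> A u^-1 -> A o -> eu != eo ->
  has_weight theta eu u -> has_weight theta eo o ->
  components theta f c -> components theta ((u + o) * f) c' ->
  (forall d, A (c' d)) -> forall d, A (c d).
Proof.
move=> A0 AB AM u0 Au Ao neq hu ho fc fc' Ac'.
have rec d : c d = u^-1 * (c' (d + eu) - o * c (d + (eu - eo))).
  have := components_uniq fc'; rewrite mulrDl.
  move/(_ _ (componentsD (components_weightM hu fc) (components_weightM ho fc))).
  move/(_ (d + eu)) => ->.
  by rewrite /= [d + eu - eu]addrK -[d + eu - eo]addrA addrK mulKf.
have [B cB] := components_bounded fc.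
pose sg : int := Num.sg (eu - eo).
(* sg * d increases strictly along d -> d + (eu - eo). *)
have key (N : nat) : forall d, B%:Z - N%:Z < sg * d -> A (c d).
  elim: N => [|N IH] d hd.
    rewrite cB //; move: hd; rewrite /sg.
    have [||] := ltrgt0P (eu - eo) => h; rewrite ?sgr0; lia.
  rewrite rec; apply: (AM) => //; apply: (AB) => //; apply: (AM) => //; apply: IH.
  rewrite mulrDr -normrEsg; have : 0 < `|eu - eo| by rewrite normr_gt0 subr_eq0.
  lia.
move=> d; apply: (key (B + `|d| + 1)%N).
by rewrite /sg; case: (ltrgt0P (eu - eo)) => h; rewrite ?sgr0; lia.
Qed.

(** Row k of a left inverse of the exchange matrix gives weights for which mu_j t
    stays homogeneous, whereas the two terms of the exchange binomial of k have
    different weights.  At least one of these terms does not involve y_j, hence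
    is invertible in the Laurent ring of mu_j t. *)
Lemma cancel_exchange_poly t j k f : good t -> j != k ->
  Lau t f -> Lau (mutate_seed j t) (exchange_poly (cvar t) (exmx t) k * f) ->
  Lau (mutate_seed j t) f.
Proof.
move=> gt jk Lf LQf; have [O [c0 [c0n OB]]] := good_left_inv gt.
pose w i := O k i.
have wB l : \sum_i w i * exmx t i l = c0 *+ (k == l).
  by have := congr1 (fun M : 'M_n => M k l) OB; rewrite !mxE.
have [theta [hK hy]] := torus_action (good_indep gt) (good_gen gt) w.
have hy' : forall i, exists d, has_weight theta d (cvar (mutate_seed j t) i).
  by apply: has_weight_mutate hy _; rewrite wB eq_sym (negbTE jk).
have components_of s g : (forall i, exists d, has_weight theta d (cvar s i)) ->
    Lau s g -> exists c, [/\ components theta g c, forall d, Lau s (c d) &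
    forall P : F -> Prop, P 0 -> (forall a b, P a -> P b -> P (a + b)) ->
      (forall d, P (c d)) -> P g].
  move=> hs; apply: (subalg_components (V := fun _ => Lau s)) => //.
  - by move=> _; apply: subalg0.
  - by move=> _ a b; apply: subalg_add.
  - by move=> _ _ a b; apply: subalg_mul.
  - by move=> a; apply: subalg_scalar.
  - move=> x [i]; have [d hd] := hs i; case=> ->.
      by exists d => //; apply: laurent_var.
    by exists (- d); [apply: laurent_varV|apply: has_weightV].
have hyw i : exists d, has_weight theta d (cvar t i) by exists (w i).
have [c [fc _ Pc]] := components_of t f hyw Lf.
have [c' [fc' Lc' _]] := components_of _ _ hy' LQf.
pose ep := \sum_i w i * pos_exponents (exmx t) k 0 i.
pose en := \sum_i w i * pos_exponents (- exmx t) k 0 i.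
have hp : has_weight theta ep (mono (cvar t) (pos_exponents (exmx t) k)).
  exact: has_weight_mono.
have hn : has_weight theta en (mono (cvar t) (pos_exponents (- exmx t) k)).
  exact: has_weight_mono.
have neq : ep != en.
  rewrite -subr_eq0 -sumrB.
  have -> : \sum_i (w i * pos_exponents (exmx t) k 0 i -
                    w i * pos_exponents (- exmx t) k 0 i)
      = c0.
    transitivity (c0 *+ (k == k)); last by rewrite eqxx.
    rewrite -wB; apply: eq_bigr => i _.
    by rewrite -mulrBr !mxE posN; congr (_ * _); ring.
  by [].
have nz i : cvar t i != 0 by exact: (good_neq0 (iota := iota)).
have inner (s : 'rV[int]_(n + r)) :
    0 <= s 0 (lshift r j) -> Lau (mutate_seed j t) (mono (cvar t) s).
  exact: laurent_mono_mutate.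
have unit (s : 'rV[int]_(n + r)) :
    s 0 (lshift r j) = 0 -> Lau (mutate_seed j t) (mono (cvar t) s)^-1.
  by move=> s0; rewrite -monoN //; apply: inner; rewrite mxE s0 oppr0.
apply: Pc => [|a b|]; [exact: subalg0|exact: subalg_add|].
have AB a b : Lau (mutate_seed j t) a -> Lau (mutate_seed j t) b ->
  Lau (mutate_seed j t) (a - b) by exact: subalgB.
have AM a b : Lau (mutate_seed j t) a -> Lau (mutate_seed j t) b ->
  Lau (mutate_seed j t) (a * b) by exact: subalg_mul.
have pos0 B : 0 <= pos_exponents B k 0 (lshift r j) by rewrite mxE le_max lexx.
have [Bjk|Bjk] := lerP (exmx t (lshift r j) k) 0.
  apply: (cancel_binomial _ AB AM _ _ _ neq hp hn fc fc' Lc').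
  - exact: subalg0.
  - exact: mono_neq0.
  - by apply: unit; rewrite mxE max_l.
  - exact: inner.
rewrite eq_sym in neq; rewrite /exchange_poly addrC in fc'.
apply: (cancel_binomial _ AB AM _ _ _ neq hn hp fc fc' Lc').
- exact: subalg0.
- exact: mono_neq0.
- by apply: unit; rewrite !mxE max_l // oppr_le0 ltW.
- exact: inner.
Qed.

(** [exchange_relation_change], up to the simultaneous change of sign of both columns;
    if b_kj = 0 then mutations at j and k commute. *)
Lemma mutated_var_laurent t j k : good t -> j != k ->
  Lau (mutate_seed j (mutate_seed k t)) (cvar (mutate_seed j t) (lshift r j)).
Proof.
move=> gt jk; set t' := mutate_seed k t; set t'' := mutate_seed j t'.
have gt' : good t' by exact: good_mutate.
have Bkk := good_diag k gt; have Bjj := good_diag j gt.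
have jk' : lshift r j != lshift r k by rewrite (inj_eq (@lshift_inj n r)).
have y'j : cvar t' (lshift r j) = cvar t (lshift r j) by rewrite cvar_mutate_other.
have [d sk] := good_skew gt.
have x''E : cvar t'' (lshift r j) =
    binomial_of (cvar t') (\row_i exmx t' i j) / cvar t (lshift r j).
  by rewrite cvar_mutate exchange_polyE y'j.
rewrite cvar_mutate exchange_polyE.
have nz s i : good s -> cvar s i != 0 by exact: (good_neq0 (iota := iota)).
have Qk : cvar t (lshift r k) * cvar t' (lshift r k) =
    binomial_of (cvar t) (\row_i exmx t i k).
  by rewrite cvar_mutate exchange_polyE mulrC divfK // nz.
have Sm (s : 'rV[int]_(n + r)) : 0 <= s 0 (lshift r j) -> Lau t'' (mono (cvar t') s).
  exact: laurent_mono_mutate.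
have Sx : Lau t'' (binomial_of (cvar t') (\row_i exmx t' i j) / cvar t (lshift r j)).
  by rewrite -x''E; apply: laurent_var.
have B'E i : i != lshift r k -> exmx t' i j = exmx t i j +
   (pos (exmx t i k) * exmx t (lshift r k) j +
    exmx t i k * pos (- exmx t (lshift r k) j)).
  by move=> ik; rewrite mutate_exmxE // (negbTE ik) (negbTE jk).
have B'k : exmx t' (lshift r k) j = - exmx t (lshift r k) j.
  by rewrite mutate_exmxE // eqxx.
have [b0|b0|b0] := ltrgt0P (exmx t (lshift r k) j).
- apply: (exchange_relation_change (y' := cvar t') (k := lshift r k)
    (e := \row_i exmx t i k) (a' := \row_i exmx t' i j)) => //.
  + by move=> i; apply: nz.
  + by move=> i; apply: nz.
  + by move=> i ik; rewrite cvar_mutate_other.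
  + by rewrite mxE.
  + by rewrite mxE.
  + by rewrite mxE -(skew_data_sign _ _ sk).
  + by rewrite mxE.
  + by rewrite [LHS]mxE B'k mxE.
  + by move=> i ik; rewrite [LHS]mxE B'E // !mxE; move: b0; lia.
- rewrite -binomial_ofN; rewrite -binomial_ofN in Sx.
  rewrite -binomial_ofN in Qk.
  apply: (exchange_relation_change (y' := cvar t') (k := lshift r k)
    (e := - \row_i exmx t i k) (a' := - \row_i exmx t' i j)) => //.
  + by move=> i; apply: nz.
  + by move=> i; apply: nz.
  + by move=> i ik; rewrite cvar_mutate_other.
  + by rewrite !mxE Bjj oppr0.
  + by rewrite !mxE Bkk oppr0.
  + by rewrite !mxE oppr_lt0 (skew_data_sign _ _ sk).
  + by rewrite !mxE oppr_gt0.
  + by rewrite ![(- _ : 'rV_ _) _ _]mxE ![(\row_i _) _ _]mxE B'k.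
  + move=> i ik; rewrite [LHS]mxE [X in - X]mxE B'E // !mxE; move: b0.
    move: (exmx t i j) (exmx t i k) (exmx t (lshift r k) j) => A C D; nia.
- have Bjk : exmx t (lshift r j) k = 0 by apply: skew_data_eq0 sk b0.
  have col i : exmx t' i j = exmx t i j.
    have [->|ik] := eqVneq i (lshift r k); first by rewrite B'k b0 oppr0.
    by rewrite B'E // b0; lia.
  suff -> : binomial_of (cvar t) (\row_i exmx t i j) =
    binomial_of (cvar t') (\row_i exmx t' i j) by [].
  have -> : \row_i exmx t' i j = \row_i exmx t i j.
    by apply/rowP=> i; rewrite [LHS]mxE [RHS]mxE; apply: col.
  by rewrite /binomial_of !mono_mutate // !mxE b0 ?oppr0 ?maxxx.
Qed.

Lemma laurent_mutate2 t j k f : good t -> j != k ->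
  Lau t f -> Lau (mutate_seed j t) f -> Lau (mutate_seed k t) f ->
  Lau (mutate_seed j (mutate_seed k t)) f.
Proof.
move=> gt jk Lf Ljf Lkf; set t' := mutate_seed k t; set t'' := mutate_seed j t'.
have gt' : good t' by exact: good_mutate.
have jk' : lshift r j != lshift r k by rewrite (inj_eq (@lshift_inj n r)).
pose Q := exchange_poly (cvar t') (exmx t') k.
have QE : Q = exchange_poly (cvar t) (exmx t) k.
  by apply: exchange_poly_mutate gt.
have Q0 : Q != 0.
  exact: (exchange_poly_neq0 (iota := iota) charK _ _ (good_indep gt')).
have LQ' : Lau t' Q by apply: laurent_exchange_poly.
have LQ : Lau t'' Q.
  by apply: subalg_add; apply: laurent_mono_mutate => //; rewrite mxE le_max lexx.
have yk : cvar t (lshift r k) = Q * (cvar t'' (lshift r k))^-1.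
  rewrite cvar_mutate_other 1?eq_sym // cvar_mutate -QE invfM invrK mulrA.
  by rewrite divff // mul1r.
have exponent g : exchange_ring t j g -> exists N : nat, Lau t'' (Q ^+ N * g).
  elim=> {g} [c|g Sg|g g' _ [N LN] _ [N' LN']|g g' _ [N LN] _ [N' LN']].
  - by exists 0%N; rewrite expr0 mul1r; apply: subalg_scalar.
  - case: Sg => [->|->|[i ij]].
    + exists 0%N; rewrite expr0 mul1r.
      have <- : cvar t' (lshift r j) = cvar t (lshift r j).
        by rewrite cvar_mutate_other.
      exact: laurent_var_mutate.
    + by exists 0%N; rewrite expr0 mul1r; apply: mutated_var_laurent.
    + have [->|ik] := eqVneq i (lshift r k).
        case=> ->; [exists 0%N|exists 1%N]; rewrite yk.
          by rewrite expr0 mul1r; apply: subalg_mul => //; apply: laurent_varV.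
        by rewrite expr1 invfM invrK mulrA divff // mul1r; apply: laurent_var.
      have <- : cvar t'' i = cvar t i by rewrite !cvar_mutate_other.
      by case=> ->; exists 0%N; rewrite expr0 mul1r;
        [apply: laurent_var|apply: laurent_varV].
  - exists (N + N')%N; rewrite mulrDr; apply: subalg_add.
      by rewrite exprD mulrAC mulrC; apply: subalg_mul => //; apply: subalgX.
    by rewrite exprD -mulrA; apply: subalg_mul => //; apply: subalgX.
  - by exists (N + N')%N; rewrite exprD mulrACA; apply: subalg_mul.
have [N LN] := exponent f (laurent_inter_exchange_ring gt Lf Ljf).
elim: N LN => [|N IH]; first by rewrite expr0 mul1r.
rewrite exprS -mulrA => LN; apply: IH.
apply: (cancel_exchange_poly gt' jk) => //.
by apply: subalg_mul => //; apply: subalgX.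
Qed.

Definition upper_bound t f : Prop := Lau t f /\ forall k, Lau (mutate_seed k t) f.

(** Upper bounds are invariant under mutation, because mutation is an involution and
    by [laurent_mutate2] for the other neighbours. *)
Lemma upper_bound_mutate t k f : good t ->
  upper_bound t f -> upper_bound (mutate_seed k t) f.
Proof.
move=> gt [Lf Lkf]; split=> // j.
have [->|jk] := eqVneq j k; first by rewrite (mutate_seedK charK k gt).
exact: laurent_mutate2.
Qed.

(** Each cluster variable lies in the upper bound of its own seed, which is also the
    upper bound of every other seed. *)
Theorem laurent_phenomenon s t f : good s -> mut_equiv s t ->
  cluster_algebra iota s f -> Lau t f.
Proof.
move=> gs st.
have fwd u g : mut_equiv s u -> upper_bound s g -> upper_bound u g.
  move=> su Ug; elim: su => // k v sv IH; apply: upper_bound_mutate => //.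
  exact: good_mut_equiv gs sv.
have bwd u g : mut_equiv s u -> upper_bound u g -> upper_bound s g.
  elim=> // k v sv IH Ug; apply: IH.
  have gv : good v by exact: good_mut_equiv gs sv.
  rewrite -(mutate_seedK charK k gv); apply: upper_bound_mutate => //.
  exact: good_mutate.
apply: subalg_sub => _ [u [i [su ->]]].
have [//] : upper_bound t (cvar u i).
apply: fwd => //; apply: (bwd u) => //; split; first exact: laurent_var.
by move=> k; apply: laurent_var_mutate; apply: good_mut_equiv gs su.
Qed.

End LaurentPhenomenon.

(** * Rigidity of log-canonical Poisson tori *)

Lemma ratio_max (T : eqType) (A D : T -> int) (s : seq T) x0 :
  x0 \in s -> (forall x, x \in s -> 0 < D x) ->
  exists2 p, p \in s & forall x, x \in s -> A x * D p <= A p * D x.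
Proof.
elim: s x0 => [//|y s IH] x0 _ D0.
have Dy : 0 < D y by apply: D0; rewrite mem_head.
case: s IH D0 => [|z s] IH D0.
  by exists y; rewrite ?mem_head // => x; rewrite inE => /eqP ->.
have [x xs|p ps pmax] := IH z (mem_head _ _).
  by apply: D0; rewrite inE xs orbT.
have Dp : 0 < D p by apply: D0; rewrite inE ps orbT.
have [le_yp|lt_py] := lerP (A y * D p) (A p * D y).
  exists p; first by rewrite inE ps orbT.
  by move=> x; rewrite inE => /predU1P[->//|/pmax].
exists y; first exact: mem_head.
move=> x; rewrite inE => /predU1P[->//|xs].
have Dx : 0 < D x by apply: D0; rewrite inE xs orbT.
rewrite -(ler_pM2r Dp) mulrAC; apply: (@le_trans _ _ (A p * D x * D y)).
  by rewrite ler_pM2r ?pmax.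
by rewrite mulrAC [leRHS]mulrAC ler_pM2r // ltW.
Qed.

Section LogarithmicDerivatives.
Variable F : fieldType.
Hypothesis natF0 : forall j : nat, (j%:R == 0 :> F) = (j == 0)%N.
Implicit Types X Y : {poly F}.

(** If X - Y = (t^d) R with R(0) nonzero and d > 0, the coefficient of t^(d-1) in
    (X - Y)' Y = (X - Y) Y' is d R(0) = 0. *)
Lemma eq_log_deriv X Y : X^`() * Y = X * Y^`() ->
  X.[0] = 1 -> Y.[0] = 1 -> X = Y.
Proof.
move=> XY X0 Y0; apply/eqP; rewrite -subr_eq0; apply/negPn/negP=> D0.
have DY : (X - Y)^`() * Y = (X - Y) * Y^`().
  by rewrite derivB !mulrBl XY [Y * Y^`()]mulrC.
have [d [R]] := multiplicity_XsubC (X - Y) 0.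
rewrite D0 subr0 /= => R0 DE.
case: d DE => [|d] DE.
  move: R0; rewrite /root; have := congr1 (fun q : {poly F} => q.[0]) DE.
  by rewrite expr0 mulr1 => <-; rewrite !hornerE X0 Y0 subrr eqxx.
have : 'X^d * (R^`() * 'X * Y + d.+1%:R *: R * Y) = 'X^d * (R * 'X * Y^`()).
  have := DY; rewrite DE derivM derivXn /= exprS => e.
  transitivity ((R^`() * ('X * 'X^d) + R * ('X^d *+ d.+1)) * Y).
    rewrite -mulr_natl -scaler_nat -!mul_polyC; rewrite polyC_natr; ring.
  by rewrite e; ring.
have Xd : 'X^d != 0 :> {poly F} by rewrite monic_neq0 ?monicXn.
move/(mulfI Xd)/(congr1 (fun q : {poly F} => q.[0])).
rewrite !(hornerE, mulr0, mul0r, add0r, Y0, mulr1) => /eqP.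
rewrite mulf_eq0 natF0 /= => h; move: R0; rewrite /root.
by rewrite h.
Qed.

Lemma mul_eq1_const X Y : X * Y = 1 -> X.[0] = 1 -> X = 1.
Proof.
move=> XY X0.
have XU : X \is a GRing.unit by apply/unitrP; exists Y; rewrite mulrC XY.
have /size_poly1P[c _ Xc] : size X == 1%N.
  by rewrite poly_unitE in XU; case/andP: XU.
by move: X0; rewrite Xc hornerC => ->.
Qed.

End LogarithmicDerivatives.

Section SkewForm.
Variables (m : nat) (L : 'M[int]_m).
Implicit Types s : 'rV[int]_m.

Definition skew_form s1 s2 : int := (s1 *m L *m s2^T) 0 0.
Local Notation lam := skew_form.
Local Notation unit k := (delta_mx 0 k : 'rV[int]_m).

Lemma skew_formDl a b s : lam (a + b) s = lam a s + lam b s.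
Proof. by rewrite /lam !mulmxDl mxE. Qed.

Lemma skew_formDr a b s : lam s (a + b) = lam s a + lam s b.
Proof. by rewrite /lam linearD /= mulmxDr mxE. Qed.

Lemma skew_formE s1 s2 : lam s1 s2 = \sum_i s1 0 i * lam (unit i) s2.
Proof.
rewrite /lam -mulmxA mxE; apply: eq_bigr => i _; congr (_ * _).
by rewrite -[in RHS]mulmxA -rowE [RHS]mxE.
Qed.

Lemma skew_form_unit j k : lam (unit j) (unit k) = L j k.
Proof. by rewrite /lam -rowE trmx_delta -colE !mxE. Qed.

Hypothesis Lskew : L^T = - L.

Lemma skew_form_antisym s1 s2 : lam s1 s2 = - lam s2 s1.
Proof.
have -> : lam s1 s2 = ((s1 *m L *m s2^T)^T) 0 0 by rewrite mxE.
by rewrite !trmx_mul trmxK Lskew mulNmx mulmxN mulmxA mxE.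
Qed.

Lemma skew_formEr s1 s2 : lam s1 s2 = \sum_i s2 0 i * lam s1 (unit i).
Proof.
rewrite skew_form_antisym skew_formE -sumrN; apply: eq_bigr => i _.
by rewrite [lam s1 _]skew_form_antisym mulrN.
Qed.

Lemma skew_form_alt s : lam s s = 0.
Proof. by have := skew_form_antisym s s; lia. Qed.

End SkewForm.

Section Rigidity.
Import mpoly.
Variables (K F : fieldType) (iota : {rmorphism K -> F}) (m : nat).
Variables (y : 'I_m -> F) (L : 'M[int]_m) (wt : 'I_m -> nat).
Hypothesis natF0 : forall j : nat, (j%:R == 0 :> F) = (j == 0)%N.
Hypothesis indep : forall p : {mpoly K[m]}, mmap iota y p = 0 -> p = 0.
Hypothesis Lskew : L^T = - L.
Implicit Types s : 'rV[int]_m.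
Local Notation lam := (skew_form L).
Local Notation unit k := (delta_mx 0 k : 'rV[int]_m).
Local Notation formal := (seq (K * 'rV[int]_m)).
Local Notation ev := (lsum iota (mono y)).

Definition degree s : int := \sum_i (wt i)%:Z * s 0 i.
Local Notation deg := degree.

Lemma degreeD a b : deg (a + b) = deg a + deg b.
Proof. by rewrite -big_split; apply: eq_bigr => i _; rewrite mxE mulrDr. Qed.

Lemma degree0 : deg 0 = 0.
Proof. by apply: big1 => i _; rewrite mxE mulr0. Qed.

Lemma degreeN a : deg (- a) = - deg a.
Proof. by apply/eqP; rewrite -addr_eq0 -degreeD addNr degree0. Qed.

Lemma degree_unit k : deg (unit k) = wt k.
Proof.
rewrite /deg (bigD1 k) //= mxE !eqxx mulr1 big1 ?addr0 // => i ik.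
by rewrite mxE (negbTE ik) andbF mulr0.
Qed.

Lemma intF0 (z : int) : (z%:~R == 0 :> F) = (z == 0).
Proof. by case: z => j; rewrite ?NegzE ?mulrNz ?oppr_eq0 -pmulrn natF0. Qed.

(** Squared length of the class of s modulo the radical of the form. *)
Definition sqnorm s : int := \sum_j lam (unit j) s ^+ 2.
Definition inner s1 s2 : int := \sum_j lam (unit j) s1 * lam (unit j) s2.

Section Face.
Variables (p : 'rV[int]_m).
Hypothesis p_deg : 0 < deg p.

(** The differential at p of the quadratic form sqnorm / degree^2, up to a factor. *)
Definition height s : int := deg s * sqnorm p - deg p * inner p s.
(** s and a multiple of p have the same class modulo the radical of lam. *)
Definition proportional s : Prop :=
  forall j, deg p * lam (unit j) s = deg s * lam (unit j) p.

Lemma heightD a b : height (a + b) = height a + height b.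
Proof.
have innerD : inner p (a + b) = inner p a + inner p b.
  by rewrite /inner -big_split; apply: eq_bigr => j _; rewrite skew_formDr mulrDr.
by rewrite /height degreeD innerD; ring.
Qed.

Lemma lam0r s : lam s 0 = 0.
Proof. by have := skew_formDr L 0 0 s; rewrite addr0; lia. Qed.

Lemma height0 : height 0 = 0.
Proof.
rewrite /height degree0 mul0r sub0r /inner big1 ?mulr0 ?oppr0 // => j _.
by rewrite lam0r mulr0.
Qed.

Lemma height_p : height p = 0.
Proof. by rewrite /height /inner /sqnorm subrr. Qed.

Lemma proportional0 : proportional 0.
Proof. by move=> j; rewrite lam0r degree0 mulr0 mul0r. Qed.

(** 2 deg(s) height(s) bounds the squared length of deg(p) s - deg(s) p from above. *)
Lemma maximal_slope s : 0 < deg s ->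
  sqnorm s * deg p ^+ 2 <= sqnorm p * deg s ^+ 2 ->
  0 <= height s /\ (height s = 0 -> proportional s).
Proof.
move=> s_deg smax.
pose D := \sum_j (deg p * lam (unit j) s - deg s * lam (unit j) p) ^+ 2.
have D0 : 0 <= D by apply: sumr_ge0 => j _; apply: sqr_ge0.
(* Expand D and use the maximality of p for the term in sqnorm s. *)
have DE : D <= 2%:R * deg s * height s.
  have -> : D = deg p ^+ 2 * sqnorm s - 2%:R * deg p * deg s * inner p s +
      deg s ^+ 2 * sqnorm p.
    rewrite /D /sqnorm /inner; move: (deg p) (deg s) => dp ds.
    rewrite !mulr_sumr -sumrB -big_split /=.
    by apply: eq_bigr => j _; ring.
  by rewrite /height; nia.
split=> [|h0 j]; first by nia.
have /eqP : D = 0 by apply/eqP;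
  rewrite eq_le D0 andbT -[leRHS](mulr0 (2%:R * deg s)) -h0.
rewrite psumr_eq0 => [/allP /(_ j (mem_index_enum j))|i _]; last exact: sqr_ge0.
by rewrite /= sqrf_eq0 subr_eq0 => /eqP.
Qed.

Lemma proportional_lam_p s : proportional s -> lam s p = 0.
Proof.
move=> sp; have : deg p * lam p s = 0.
  transitivity (deg s * lam p p); last by rewrite skew_form_alt ?mulr0.
  rewrite (skew_formE L p s) (skew_formE L p p) !big_distrr.
  by apply: eq_bigr => i _; rewrite /= mulrCA sp mulrCA.
rewrite (skew_form_antisym Lskew) mulrN => /eqP; rewrite oppr_eq0 mulf_eq0.
by rewrite gt_eqF //= => /eqP.
Qed.

(** The face of height 0 Poisson commutes. *)
Lemma proportional_lam s1 s2 : proportional s1 -> proportional s2 -> lam s1 s2 = 0.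
Proof.
move=> h1 h2; have : deg p * lam s1 s2 = 0.
  transitivity (deg s2 * lam s1 p); last by rewrite proportional_lam_p ?mulr0.
  rewrite (skew_formE L s1 s2) (skew_formE L s1 p) !big_distrr.
  by apply: eq_bigr => i _; rewrite /= mulrCA h2 mulrCA.
by move/eqP; rewrite mulf_eq0 gt_eqF //= => /eqP.
Qed.

(** The projection to the face of height 0, the degree being recorded by 'X so that
    'X d/d'X is the Euler derivation. *)
Definition face_mono s : {poly F} :=
  if height s == 0 then (mono y s)%:P * 'X^`|deg s| else 0.
Local Notation h := face_mono.

Definition in_cone s : bool := (0 <= height s) && (0 <= deg s).

Lemma in_cone0 : in_cone 0.
Proof. by rewrite /in_cone height0 degree0 lexx. Qed.

Lemma face_mono0 : h 0 = 1.
Proof. by rewrite /h height0 eqxx mono_row0 degree0 mulr1. Qed.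

Lemma in_coneD a b : in_cone a -> in_cone b -> in_cone (a + b).
Proof.
case/andP=> ha da /andP[hb db]; apply/andP.
by rewrite heightD degreeD; split; apply: addr_ge0.
Qed.

Lemma face_monoD a b : in_cone a -> in_cone b -> h (a + b) = h a * h b.
Proof.
case/andP=> ha da /andP[hb db]; rewrite /h heightD paddr_eq0 //.
case: eqP => _; last by rewrite mul0r.
case: eqP => _; last by rewrite mulr0.
rewrite monoD; last exact: indep_neq0 indep.
rewrite degreeD; have -> : absz (deg a + deg b) = (absz (deg a) + absz (deg b))%N.
  by move: (deg a) (deg b) da db; lia.
by rewrite exprD polyCM; ring.
Qed.

Lemma face_mono_deriv s : 0 <= deg s -> 'X * (h s)^`() = (deg s)%:~R *: h s.
Proof.
rewrite /h => ds; case: eqP => _; last by rewrite deriv0 mulr0 scaler0.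
rewrite derivM derivC mul0r add0r derivXn.
case: (deg s) ds => // -[|d] _ /=; first by rewrite !mulr0 scale0r.
by rewrite mulrCA [_ * (_ *+ _)]mulrnAr -exprS mulrnAr -pmulrn scaler_nat.
Qed.

Local Notation cst := (@polyC F \o iota).
Definition lead := lsum cst h.

(** The graph of the ring morphism that projects the Laurent polynomials with
    exponents in the cone to the face of height 0.  A relation avoids
    building the subring. *)
Definition has_lead (x : F) (z : {poly F}) : Prop :=
  exists f : formal, [/\ forall a, a \in f -> in_cone a.2, ev f = x & lead f = z].

Lemma has_lead_uniq x z z' : has_lead x z -> has_lead x z' -> z = z'.
Proof.
move=> [f [_ fx <-]] [f' [_ f'x <-]]; apply: (lsum_indep indep).
by rewrite fx f'x.
Qed.

Lemma has_lead_formal (f : formal) :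
  (forall a, a \in f -> in_cone a.2) -> has_lead (ev f) (lead f).
Proof. by move=> fc; exists f. Qed.

Lemma has_leadD x z x' z' : has_lead x z -> has_lead x' z' ->
  has_lead (x + x') (z + z').
Proof.
move=> [f [fc <- <-]] [f' [fc' <- <-]]; exists (f ++ f').
split; [|exact: lsum_cat|exact: lsum_cat].
by move=> a; rewrite mem_cat => /orP[/fc|/fc'].
Qed.

Lemma has_leadM x z x' z' : has_lead x z -> has_lead x' z' ->
  has_lead (x * x') (z * z').
Proof.
move=> [f [fc <- <-]] [f' [fc' <- <-]]; exists (lmul f f'); split.
- by move=> a /mem_lmul[b [c [/fc bf /fc' cf ->]]]; apply: in_coneD.
- by apply: lsum_mul => a b _ _; apply: monoD; apply: indep_neq0 indep.
- by apply: lsum_mul => a b /fc ca /fc' cb; apply: face_monoD.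
Qed.

Lemma has_lead_term c s : in_cone s ->
  has_lead (iota c * mono y s) (cst c * h s).
Proof.
move=> sc; exists [:: (c, s)]; rewrite /lead /lsum !big_seq1; split=> // a.
by rewrite inE => /eqP ->.
Qed.

Lemma has_lead1 : has_lead 1 1.
Proof.
by have := has_lead_term 1 in_cone0; rewrite mono_row0 face_mono0 !rmorph1 !mul1r.
Qed.

Lemma has_lead0 : has_lead 0 0.
Proof. by exists [::]; rewrite /lead /lsum !big_nil. Qed.

Lemma has_lead_sum (I : eqType) (r : seq I) (X : I -> F) (Z : I -> {poly F}) :
  (forall i, i \in r -> has_lead (X i) (Z i)) ->
  has_lead (\sum_(i <- r) X i) (\sum_(i <- r) Z i).
Proof.
elim: r => [|i r IH] XZ; first by rewrite !big_nil; apply: has_lead0.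
rewrite !big_cons; apply: has_leadD; first by apply: XZ; rewrite mem_head.
by apply: IH => j jr; apply: XZ; rewrite inE jr orbT.
Qed.

Lemma has_lead_mmap1 (X : 'I_m -> F) (Z : 'I_m -> {poly F}) (a : 'X_{1..m}) :
  (forall i, has_lead (X i) (Z i)) -> has_lead (mmap1 X a) (mmap1 Z a).
Proof.
move=> XZ; rewrite /mmap1; elim/big_ind2: _ => [|x1 x2 y1 y2|i _].
- exact: has_lead1.
- exact: has_leadM.
elim: (a i) => [|j IH]; first by rewrite !expr0; apply: has_lead1.
by rewrite !exprS; apply: has_leadM.
Qed.

(** Evaluating the leading form at 'X = 1 gives a vanishing sum of distinct Laurent
    monomials. *)
Lemma lead_eq0 (q : formal) x : uniq (map snd q) -> lead q = 0 ->
  x \in q -> height x.2 = 0 -> x.1 = 0.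
Proof.
move=> q_uniq q0 xq hx; pose q' := [seq a <- q | height a.2 == 0].
have ev0 : ev q' = ev [::].
  rewrite [RHS]/lsum big_nil -[RHS](horner0 1) -q0 /lead /lsum horner_sum.
  rewrite big_filter big_mkcond; apply: eq_bigr => a _ /=.
  rewrite /h hornerM hornerC; case: eqP => _; last by rewrite horner0 mulr0.
  by rewrite hornerCM hornerXn expr1n mulr1.
have := lsum_indep indep iota (fun s => (s == x.2)%:R) ev0.
rewrite {2}/lsum big_nil /lsum big_filter (big_rem x) //= hx eqxx eqxx mulr1.
rewrite big_seq_cond big1 ?addr0.
  by move=> /eqP; rewrite fmorph_eq0 => /eqP.
move=> a /andP[aq _]; case: eqP => [e|_]; last by rewrite mulr0.
have := q_uniq; rewrite (perm_uniq (perm_map snd (perm_to_rem xq))) /=.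
by rewrite -e map_f.
Qed.

(** u_k = 1 + f_k and v_k = 1 + g_k are the multipliers of two substitutions,
    y_k -> y_k u_k and y_k -> y_k v_k.  [poisson] says that the first one preserves
    the bracket, and [inverse] that it maps y_k v_k to y_k. *)
Section TwoAutomorphisms.
Variables (f g : 'I_m -> formal).
Let F1 k : formal := (1, 0) :: f k.
Let G1 k : formal := (1, 0) :: g k.
Let u k := ev (F1 k).
Hypothesis f_deg : forall k x, x \in f k -> 0 < deg x.2.
Hypothesis g_deg : forall k x, x \in g k -> 0 < deg x.2.
Hypothesis f_max : forall k x, x \in f k ->
  sqnorm x.2 * deg p ^+ 2 <= sqnorm p * deg x.2 ^+ 2.
Hypothesis g_max : forall k x, x \in g k ->
  sqnorm x.2 * deg p ^+ 2 <= sqnorm p * deg x.2 ^+ 2.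
Hypothesis poisson : forall j k, lsum iota (mono y)
  [seq (a.1 * b.1 * (lam (unit j + a.2) (unit k + b.2) - L j k)%:~R,
        a.2 + b.2) | a <- F1 j, b <- F1 k] = 0.
Hypothesis inverse : forall k,
  1 = u k * \sum_(a <- G1 k) iota a.1 * mono y a.2 * mono u a.2.
Hypothesis u_neq0 : forall k, u k != 0.
Hypothesis p_norm : 0 < sqnorm p.

Let P k := lead (F1 k).
Let V k := lead (G1 k).
Let slope j := lam (unit j) p.

Lemma F1_in_cone k x : x \in F1 k ->
  in_cone x.2 /\ (height x.2 = 0 -> proportional x.2).
Proof.
rewrite inE => /predU1P[->|xf] /=.
  by split; [exact: in_cone0|move=> _; exact: proportional0].
have [h0 hp] := maximal_slope (f_deg xf) (f_max xf).
by rewrite /in_cone h0 ltW ?(f_deg xf).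
Qed.

Lemma G1_in_cone k x : x \in G1 k ->
  in_cone x.2 /\ (height x.2 = 0 -> proportional x.2).
Proof.
rewrite inE => /predU1P[->|xg] /=.
  by split; [exact: in_cone0|move=> _; exact: proportional0].
have [h0 hp] := maximal_slope (g_deg xg) (g_max xg).
by rewrite /in_cone h0 ltW ?(g_deg xg).
Qed.

Lemma leadE (q : formal) : lead ((1, 0) :: q) = 1 + lead q.
Proof. by rewrite /lead /lsum big_cons /= !rmorph1 mul1r face_mono0. Qed.

Lemma lead_at0 (q : formal) : (forall x, x \in q -> 0 < deg x.2) ->
  (lead ((1, 0) :: q)).[0] = 1.
Proof.
move=> qd;
  rewrite leadE hornerD hornerC /lead /lsum horner_sum big_seq big1 ?addr0 //.
move=> x xq; rewrite /face_mono; case: eqP => _; rewrite !hornerE ?mulr0 //.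
by rewrite expr0n; case: (deg x.2) (qd x xq) => [[|d]|d] //= _; rewrite !mulr0.
Qed.

(** The leading form of the Poisson relation.  On the face lam(s1,s2) = 0 and
    deg(p) lam(e_j,s) = deg(s) slope(j), so the bracket only differentiates along
    the degree. *)
Lemma lead_poisson j k :
  (slope j)%:~R *: (P j * ('X * (P k)^`())) = (slope k)%:~R *: ('X * (P j)^`() * P k).
Proof.
have euler i : 'X * (P i)^`() =
    \sum_(a <- F1 i) (deg a.2)%:~R *: (cst a.1 * h a.2).
  rewrite /P /lead /lsum raddf_sum mulr_sumr big_seq [RHS]big_seq.
  apply: eq_bigr => a /F1_in_cone[/andP[_ da] _] /=.
  rewrite derivM derivC mul0r add0r mulrCA face_mono_deriv //.
  by rewrite scalerAr.
have : lsum cst h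
  [seq (a.1 * b.1 * (lam (unit j + a.2) (unit k + b.2) - L j k)%:~R,
        a.2 + b.2) | a <- F1 j, b <- F1 k] = 0.
  have <- : lsum cst h [::] = 0 by rewrite /lsum big_nil.
  by apply: (lsum_indep indep); rewrite poisson /lsum big_nil.
move/(congr1 (fun q => (deg p)%:~R *: q)); rewrite scaler0 => e0.
apply/eqP; rewrite -subr_eq0 -[X in _ == X]e0; apply/eqP.
rewrite !euler /P /lead /lsum big_allpairs_dep /=.
rewrite !mulr_suml !scaler_sumr -sumrB big_seq [RHS]big_seq.
apply: eq_bigr => a aF; rewrite !mulr_sumr !scaler_sumr -sumrB.
rewrite big_seq [RHS]big_seq; apply: eq_bigr => b bF.
have [ca pa] := F1_in_cone aF; have [cb pb] := F1_in_cone bF.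
rewrite (face_monoD ca cb).
have [ha|ha] := eqVneq (height a.2) 0; last first.
  have -> : h a.2 = 0 by rewrite /face_mono (negbTE ha).
  by rewrite !(mulr0, mul0r, scaler0) subr0.
have [hb|hb] := eqVneq (height b.2) 0; last first.
  have -> : h b.2 = 0 by rewrite /face_mono (negbTE hb).
  by rewrite !(mulr0, mul0r, scaler0) subr0.
have {}pa := pa ha; have {}pb := pb hb.
have cE : deg p * (lam (unit j + a.2) (unit k + b.2) - L j k) =
    deg b.2 * slope j - deg a.2 * slope k.
  rewrite skew_formDl !skew_formDr skew_form_unit (proportional_lam pa pb).
  rewrite [lam a.2 (unit k)](skew_form_antisym Lskew) /slope -pa -pb; ring.
set c := _ - L j k in cE *.
have {}cE : (deg p)%:~R * c%:~R =
    (deg b.2)%:~R * (slope j)%:~R - (deg a.2)%:~R * (slope k)%:~R :> F.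
  by rewrite -!intrM -intrB cE.
have -> : iota (a.1 * b.1 * c%:~R) = iota a.1 * iota b.1 * c%:~R.
  by rewrite !rmorphM rmorph_int.
transitivity (((deg p)%:~R * c%:~R)%:P *
    ((iota a.1)%:P * (iota b.1)%:P * (h a.2 * h b.2)) : {poly F}).
  by rewrite cE -!mul_polyC polyCB !polyCM; ring.
by rewrite -mul_polyC !polyCM; ring.
Qed.

(** The logarithmic derivative of X is c / slope(j0) times the one of P_j0. *)
Let has_log_deriv (X : {poly F}) (j0 : 'I_m) (c : int) : Prop :=
  (slope j0)%:~R *: (P j0 * ('X * X^`())) = c%:~R *: ('X * (P j0)^`() * X).

Lemma log_deriv_mul j0 X Y c d :
  has_log_deriv X j0 c -> has_log_deriv Y j0 d ->
  has_log_deriv (X * Y) j0 (c + d).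
Proof.
rewrite /has_log_deriv -!mul_polyC => TX TY; rewrite derivM intrD polyCD.
transitivity ((((slope j0)%:~R)%:P * (P j0 * ('X * X^`()))) * Y +
   X * (((slope j0)%:~R)%:P * (P j0 * ('X * Y^`())))); first by ring.
by rewrite TX TY; ring.
Qed.

Lemma log_deriv_monomial j0 (a : 'X_{1..m}) :
  has_log_deriv (mmap1 P a) j0 (\sum_k slope k * (a k)%:Z).
Proof.
rewrite /mmap1; elim/big_rec2: _ => [|k c X _ TX].
  by rewrite /has_log_deriv derivC scale0r !mulr0 scaler0.
apply: log_deriv_mul TX; elim: (a k) => [|d IH].
  by rewrite expr0 mulr0 /has_log_deriv derivC scale0r !mulr0 scaler0.
rewrite exprS [X in has_log_deriv _ _ X](_ : _ = slope k + slope k * d%:Z); last by lia.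
by apply: log_deriv_mul IH; apply: lead_poisson.
Qed.

Lemma exists_slope_neq0 : exists j0, slope j0 != 0.
Proof.
apply/existsP; apply: contraLR p_norm => /existsPn n0.
rewrite /sqnorm big1 // => j _; have := n0 j; rewrite negbK => /eqP.
by rewrite /slope => ->; rewrite expr0n.
Qed.

Lemma P_at0 k : (P k).[0] = 1.
Proof. by apply: lead_at0; apply: f_deg. Qed.

Lemma monomial_at0 (a : 'X_{1..m}) : (mmap1 P a).[0] = 1.
Proof.
rewrite /mmap1 horner_prod big1 // => k _.
by rewrite horner_exp P_at0 expr1n.
Qed.

(** Both monomials have the same logarithmic derivative and the value 1 at 0. *)
Lemma lead_monomial_eq (a b : 'X_{1..m}) :
  \sum_k slope k * (a k)%:Z = \sum_k slope k * (b k)%:Z -> mmap1 P a = mmap1 P b.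
Proof.
move=> ab; apply: (eq_log_deriv natF0); [|exact: monomial_at0..].
have [j0 nz] := exists_slope_neq0.
have Ta := log_deriv_monomial j0 a; have Tb := log_deriv_monomial j0 b.
rewrite -ab in Tb; move: Ta Tb; rewrite /has_log_deriv; set c := (\sum_k _)%:~R.
set X := mmap1 P a; set Y := mmap1 P b => TX TY.
have nz' : (slope j0)%:~R *: (P j0 * 'X) != 0 :> {poly F}.
  rewrite scaler_eq0 intF0 (negbTE nz) mulf_eq0 polyX_eq0 orbF /=.
  by apply/eqP=> P0; have := P_at0 j0; rewrite P0 horner0 => /eqP;
    rewrite eq_sym oner_eq0.
apply: (mulfI nz'); rewrite -!scalerAl -!mulrA.
transitivity (((slope j0)%:~R *: (P j0 * ('X * X^`()))) * Y).
  by rewrite -scalerAl -!mulrA.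
rewrite TX [X * _]mulrC.
transitivity (((slope j0)%:~R *: (P j0 * ('X * Y^`()))) * X); last first.
  by rewrite -scalerAl -!mulrA.
by rewrite TY -!scalerAl mulrAC.
Qed.

(** Apply the projection to 1 = u_k sum_s v_(k,s) y^s u^s, multiplied by a monomial in
    u that clears the negative exponents.  For s in the face,
    sum_i s_i slope(i) = lam(s,p) = 0, so [lead_monomial_eq] makes u^s invisible. *)
Lemma lead_inverse k : P k * V k = 1.
Proof.
have [N GN] := exponents_bounded (G1 k).
pose top : 'X_{1..m} := [multinom N | i < m].
have hu i : has_lead (u i) (P i).
  by apply: has_lead_formal => a /F1_in_cone[].
have topE (z : 'I_m -> F) : mmap1 z top = mono z (const_mx N%:Z).
  by rewrite -mono_nat; congr mono; apply/rowP=> i; rewrite !mxE mnmE.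
have uE a : a \in G1 k -> mono u a.2 * mmap1 u top = mmap1 u (shifted_monomial N a.2).
  move=> aG; rewrite topE -monoD // -mono_nat; congr mono; apply/rowP=> i.
  by rewrite !mxE mnmE gez0_abs // GN.
have lhs : has_lead (mmap1 u top) (mmap1 P top) by apply: has_lead_mmap1.
have rhs : has_lead (mmap1 u top) (P k * (\sum_(a <- G1 k)
    cst a.1 * h a.2 * mmap1 P (shifted_monomial N a.2))).
  have -> : mmap1 u top = u k * \sum_(a <- G1 k)
      iota a.1 * mono y a.2 * mmap1 u (shifted_monomial N a.2).
    rewrite -[LHS]mul1r {1}(inverse k) -mulrA; congr (_ * _).
    by rewrite mulr_suml big_seq [RHS]big_seq; apply: eq_bigr => a aG;
      rewrite -(uE a aG) mulrA.
  apply: has_leadM => //; apply: has_lead_sum => a aG; apply: has_leadM.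
    by apply: has_lead_term; case: (G1_in_cone aG).
  exact: has_lead_mmap1.
have := has_lead_uniq lhs rhs.
have -> : \sum_(a <- G1 k) cst a.1 * h a.2 * mmap1 P (shifted_monomial N a.2) =
    V k * mmap1 P top.
  rewrite /V /lead /lsum mulr_suml big_seq [RHS]big_seq.
  apply: eq_bigr => a aG; have [ac pa] := G1_in_cone aG.
  have [ha|ha] := eqVneq (height a.2) 0; last first.
    by rewrite /h (negbTE ha) !mulr0 !mul0r.
  congr (_ * _); apply: lead_monomial_eq.
  have := proportional_lam_p (pa ha); rewrite skew_formE => lam0.
  apply/eqP; rewrite -subr_eq0 -sumrB; apply/eqP; rewrite -[RHS]lam0.
  apply: eq_bigr => i _; rewrite !mnmE gez0_abs ?GN //.
  by rewrite -mulrBr addrK mulrC.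
have top0 : mmap1 P top != 0.
  by apply/eqP=> P0; have := monomial_at0 top; rewrite P0 horner0 => /eqP;
    rewrite eq_sym oner_eq0.
by rewrite mulrA -[LHS]mul1r => /(mulIf top0) <-.
Qed.

Lemma lead_trivial k : lead (f k) = 0 /\ lead (g k) = 0.
Proof.
have P1 : P k = 1 := mul_eq1_const (lead_inverse k) (P_at0 k).
have V1 : V k = 1 by have := lead_inverse k; rewrite P1 mul1r.
by move: P1 V1; rewrite /P /V !leadE => /eqP;
  rewrite -subr_eq0 addrC addKr => /eqP -> /eqP;
    rewrite -subr_eq0 addrC addKr => /eqP.
Qed.

End TwoAutomorphisms.
End Face.

(** A unipotent Poisson substitution y_k -> y_k u_k with a Laurent inverse multiplies
    the variables by central elements: otherwise take p of maximal slope among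
    all exponents, and [lead_trivial] contradicts the presence of a term at p. *)
Theorem rigidity (f g : 'I_m -> formal)
    (F1 := fun k => (1, 0) :: f k) (G1 := fun k => (1, 0) :: g k)
    (u := fun k => ev (F1 k)) :
  (forall k x, x \in f k -> 0 < deg x.2) ->
  (forall k x, x \in g k -> 0 < deg x.2) ->
  (forall k, uniq (map snd (f k))) -> (forall k, uniq (map snd (g k))) ->
  (forall k x, x \in f k -> x.1 != 0) -> (forall k x, x \in g k -> x.1 != 0) ->
  (forall j k, lsum iota (mono y)
    [seq (a.1 * b.1 * (lam (unit j + a.2) (unit k + b.2) - L j k)%:~R,
          a.2 + b.2) | a <- F1 j, b <- F1 k] = 0) ->
  (forall k,
    1 = u k * \sum_(a <- G1 k) iota a.1 * mono y a.2 * mono u a.2) ->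
  (forall k, u k != 0) ->
  forall k x, x \in f k -> forall j, lam (unit j) x.2 = 0.
Proof.
move=> fd gd fu gu fn gn poisson inverse u0 k x xf j.
apply/eqP/negPn/negP => nz.
pose S := flatten [seq map snd (f i) ++ map snd (g i) | i <- enum 'I_m].
have inS s : reflect
    (exists i, exists2 a, a \in f i \/ a \in g i & s = a.2) (s \in S).
  apply: (iffP flattenP) => [[_ /mapP[i _ ->]]|[i [a afg ->]]].
    by rewrite mem_cat => /orP[]/mapP[a ai ->]; exists i, a; auto.
  exists (map snd (f i) ++ map snd (g i)).
    by apply/mapP; exists i; rewrite ?mem_enum.
  by rewrite mem_cat; apply/orP; case: afg => ai; [left|right]; apply: map_f.
have Sd s : s \in S -> 0 < deg s.
  by case/inS=> i [a [ai|ai] ->]; [apply: fd ai|apply: gd ai].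
have xS : x.2 \in S by apply/inS; exists k, x; auto.
have [p pS pmax] := @ratio_max _ sqnorm (fun s => deg s ^+ 2) S x.2 xS
  (fun s sS => exprn_gt0 2 (Sd s sS)).
have p_deg := Sd p pS.
have x_norm : 0 < sqnorm x.2.
  rewrite /sqnorm (bigD1 j) //= ltr_pwDl ?exprn_even_gt0 //.
  by apply: sumr_ge0 => i _; apply: sqr_ge0.
have p_norm : 0 < sqnorm p.
  rewrite -(pmulr_lgt0 _ (exprn_gt0 2 (Sd _ xS))).
  by apply: lt_le_trans (pmax _ xS); rewrite mulr_gt0 // exprn_gt0.
have triv i : lead p (f i) = 0 /\ lead p (g i) = 0.
  apply: lead_trivial => // [i' a ai|i' a ai]; apply: pmax; apply/inS;
    exists i', a; auto.
case/inS: (pS) => i [a [ai|ai] pa]; have [f0 g0] := triv i.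
- have := lead_eq0 (fu i) f0 ai; rewrite -pa height_p => /(_ erefl) /eqP.
  by apply/negP; apply: fn ai.
- have := lead_eq0 (gu i) g0 ai; rewrite -pa height_p => /(_ erefl) /eqP.
  by apply/negP; apply: gn ai.
Qed.

End Rigidity.

(** * Brackets and gradings of a cluster algebra in Laurent coordinates *)

Section FormalExpansion.
Variables (K F : fieldType) (iota : {rmorphism K -> F}) (m : nat).
Variable y : 'I_m -> F.
Hypothesis y_neq0 : forall i, y i != 0.
Local Notation ev := (lsum iota (mono y)).

Lemma laurent_expansion x :
  subalg_gen iota (fun x => exists i, x = y i \/ x = (y i)^-1) x ->
  exists q, x = ev q.
Proof.
elim=> {x} [c|x [i [->|->]]|x x' _ [q ->] _ [q' ->]|x x' _ [q ->] _ [q' ->]].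
- by exists [:: (c, 0)]; rewrite /lsum big_seq1 mono_row0 mulr1.
- by exists [:: (1, delta_mx 0 i)]; rewrite lsum1 mono_delta.
- by exists [:: (1, - delta_mx 0 i)]; rewrite lsum1 monoN // mono_delta.
- by exists (q ++ q'); rewrite lsum_cat.
- by exists (lmul q q'); rewrite lsum_mul // => a b _ _; apply: monoD.
Qed.

End FormalExpansion.

Section LogCanonicalBracket.
Variables (K F : fieldType) (iota : {rmorphism K -> F}) (m : nat).
Variables (y : 'I_m -> F) (L : 'M[int]_m) (P : F -> Prop) (br : F -> F -> F).
Hypothesis y_neq0 : forall i, y i != 0.
Hypothesis Lskew : L^T = - L.
Hypothesis PE : forall x, P x <->
  subalg_gen iota (fun x => exists i, x = y i \/ x = (y i)^-1) x.
Hypothesis poisson : is_poisson iota P br.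
Hypothesis br_y : forall j k, br (y j) (y k) = (L j k)%:~R * (y j * y k).
Implicit Types s : 'rV[int]_m.
Local Notation lam := (skew_form L).
Local Notation unit k := (delta_mx 0 k : 'rV[int]_m).
Local Notation ev := (lsum iota (mono y)).

Let Py i : P (y i).
Proof. by apply/PE/subalg_in; exists i; left. Qed.

Let PyV i : P (y i)^-1.
Proof. by apply/PE/subalg_in; exists i; right. Qed.

Let P1 : P 1.
Proof. by apply/PE/subalg1. Qed.

Let PM a b : P a -> P b -> P (a * b).
Proof. by move=> /PE Pa /PE Pb; apply/PE/subalg_mul. Qed.

Lemma laurent_monomial s : P (mono y s).
Proof.
apply/PE/subalg_mono => i _; apply: subalg_in; exists i; [by left|by right].
Qed.

Let log_deriv (D : F -> F) (x c : F) : Prop := P x /\ D x = x * c.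

(** Logarithmic derivatives add up in products. *)
Lemma derivation_mono (D : F -> F) (c : 'I_m -> F) s :
  (forall a b, P a -> P b -> D (a * b) = D a * b + a * D b) ->
  (forall i, D (y i) = y i * c i) ->
  D (mono y s) = mono y s * \sum_i (s 0 i)%:~R * c i.
Proof.
move=> DM Dy.
have GM x x' a b : log_deriv D x a -> log_deriv D x' b ->
    log_deriv D (x * x') (a + b).
  by move=> [Px Dx] [Px' Dx']; split; [exact: PM|rewrite DM // Dx Dx'; ring].
have D1 : D 1 = 0.
  have := DM 1 1 P1 P1; rewrite !mulr1 mul1r => /eqP.
  by rewrite -subr_eq0 opprD addNKr oppr_eq0 => /eqP.
have G1 : log_deriv D 1 0 by split; rewrite ?D1 ?mulr0.
have GV i : log_deriv D (y i)^-1 (- c i).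
  split=> //; apply: (mulfI (y_neq0 i)).
  have := DM (y i) (y i)^-1 (Py i) (PyV i).
  rewrite divff // D1 Dy => /eqP; rewrite eq_sym addrC addr_eq0 => /eqP ->.
  by ring.
have GX x a (j : nat) : log_deriv D x a -> log_deriv D (x ^+ j) (j%:R * a).
  move=> Gx; elim: j => [|j IH]; first by rewrite expr0 mul0r.
  by rewrite exprS mulrS mulrDl mul1r; apply: GM.
suff [] : log_deriv D (mono y s) (\sum_i (s 0 i)%:~R * c i) by [].
rewrite /mono; elim/big_ind2: _ => [|x1 x2 z1 z2|i _]; [exact: G1|exact: GM|].
case: (s 0 i) => j; first by rewrite -pmulrn; apply: GX.
rewrite NegzE -exprnN -exprVn mulrNz -pmulrn mulNr -mulrN.
exact: GX.
Qed.

Lemma br_mono s1 s2 :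
  br (mono y s1) (mono y s2) = (lam s1 s2)%:~R * mono y (s1 + s2).
Proof.
have br_DM x : P x -> forall a b, P a -> P b ->
    br x (a * b) = br x a * b + a * br x b.
  by move=> Px a b Pa Pb; rewrite (br_leibniz poisson).
have br_y_mono j s : br (y j) (mono y s) = (lam (unit j) s)%:~R * (y j * mono y s).
  rewrite (derivation_mono _ (c := fun k => (L j k)%:~R * y j) (br_DM _ (Py j))).
    rewrite (skew_formEr Lskew) rmorph_sum /= mulr_suml mulr_sumr.
    by apply: eq_bigr => k _; rewrite skew_form_unit rmorphM /=; ring.
  by move=> k; rewrite br_y; ring.
rewrite (derivation_mono _ (c := fun k => - ((lam (unit k) s1)%:~R * mono y s1))
  (br_DM _ (laurent_monomial s1))).
  rewrite (skew_formEr Lskew) monoD // rmorph_sum /= mulr_sumr mulr_suml.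
  apply: eq_bigr => k _; rewrite [lam s1 _](skew_form_antisym Lskew).
  by rewrite rmorphM rmorphN /=; ring.
move=> k; rewrite (br_antisym poisson) ?br_y_mono //; last exact: laurent_monomial.
by ring.
Qed.

Lemma laurent_ev q : P (ev q).
Proof.
apply/PE; rewrite /lsum; apply: subalg_sum => a _; apply: subalg_mul.
  exact: subalg_scalar.
by apply/PE/laurent_monomial.
Qed.

Lemma br_ev_l q x : P x -> br (ev q) x = \sum_(a <- q) iota a.1 * br (mono y a.2) x.
Proof.
move=> Px.
have P0 : P 0 by apply/PE/subalg0.
have br0 : br 0 x = 0.
  have := br_linear poisson 1 P0 P0 Px; rewrite rmorph1 !mul1r addr0 => /eqP.
  by rewrite -subr_eq0 opprD addNKr oppr_eq0 => /eqP.
elim: q => [|a q IH]; first by rewrite /lsum !big_nil.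
rewrite big_cons -IH /lsum big_cons (br_linear poisson) //.
  exact: laurent_monomial.
exact: laurent_ev.
Qed.

Lemma br_ev q q' : br (ev q) (ev q') =
  \sum_(a <- q) \sum_(b <- q')
    iota (a.1 * b.1) * (lam a.2 b.2)%:~R * mono y (a.2 + b.2).
Proof.
rewrite br_ev_l; last exact: laurent_ev.
apply: eq_bigr => a _.
rewrite (br_antisym poisson); [|exact: laurent_monomial|exact: laurent_ev].
rewrite br_ev_l; last exact: laurent_monomial.
rewrite -sumrN mulr_sumr; apply: eq_bigr => b _.
rewrite br_mono (skew_form_antisym Lskew) addrC rmorphM rmorphN /=; ring.
Qed.

End LogCanonicalBracket.

Section GradedSubalgebra.
Import mpoly.
Variables (K F : fieldType) (iota : {rmorphism K -> F}) (m : nat).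
Variables (y : 'I_m -> F) (wt : 'I_m -> nat).
Variables (A : F -> Prop) (gr : nat -> F -> Prop).
Hypothesis indep : forall p : {mpoly K[m]}, mmap iota y p = 0 -> p = 0.
Hypothesis grading : is_grading iota A gr.
Hypothesis gr_y : forall i, gr (wt i) (y i).
Hypothesis A_laurent : forall x, A x ->
  subalg_gen iota (fun x => exists i, x = y i \/ x = (y i)^-1) x.
Local Notation ev := (lsum iota (mono y)).
Local Notation deg := (degree wt).

Let y_neq0 : forall i, y i != 0 := indep_neq0 indep.

Lemma gr_scale d c x : gr d x -> gr d (iota c * x).
Proof.
by move=> gx; rewrite -[_ * _]addr0; apply: (gr_linear grading) => //;
  apply: gr_zero grading _.
Qed.

Lemma gr_add d x x' : gr d x -> gr d x' -> gr d (x + x').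
Proof.
by move=> gx gx'; rewrite -[x]mul1r -(rmorph1 iota); apply: (gr_linear grading).
Qed.

Lemma gr_opp d x : gr d x -> gr d (- x).
Proof. by move=> gx; rewrite -mulN1r -(rmorph1 iota) -rmorphN; apply: gr_scale. Qed.

Lemma gr_sum d (I : Type) (r : seq I) (P : pred I) (X : I -> F) :
  (forall i, P i -> gr d (X i)) -> gr d (\sum_(i <- r | P i) X i).
Proof.
move=> gX; elim/big_ind: _ => //; first exact: gr_zero grading _.
by move=> a b; apply: gr_add.
Qed.

Definition mdegree (a : 'X_{1..m}) : nat := \sum_i wt i * a i.

Lemma gr_monomial (a : 'X_{1..m}) : gr (mdegree a) (mmap1 y a).
Proof.
rewrite /mdegree /mmap1; elim/big_ind2: _ => [|d x d' x'|i _].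
- exact: gr_one grading.
- exact: (gr_mul grading).
elim: (a i) => [|j IH]; first by rewrite expr0 muln0; apply: gr_one grading.
by rewrite exprS mulnS; apply: (gr_mul grading).
Qed.

Lemma mdegreeE (a : 'X_{1..m}) : (mdegree a)%:Z = deg (\row_i (a i)%:Z).
Proof.
rewrite /mdegree /degree (big_morph Posz PoszD erefl).
by apply: eq_bigr => i _; rewrite mxE PoszM.
Qed.

(** The abstract grading agrees with the grading by monomial degrees: multiplication
    by a monomial in the y_i, which is homogeneous for both, reduces to
    polynomials in the y_i, where directness of the sum applies. *)
Lemma gr_expansion d x : gr d x ->
  exists2 q, x = ev q & forall a, a \in q -> deg a.2 = d%:Z.
Proof.
move=> gx; have Ax : A x := gr_sub grading gx.
have [q xq] := laurent_expansion y_neq0 (A_laurent Ax).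
have [N qN] := exponents_bounded q.
pose top : 'X_{1..m} := [multinom N | i < m].
have topE : mmap1 y top = mono y (const_mx N%:Z).
  by rewrite -mono_nat; congr mono; apply/rowP=> i; rewrite !mxE mnmE.
pose D := (d + mdegree top)%N.
pose sh (a : K * 'rV[int]_m) := shifted_monomial N a.2.
have degE a : a \in q -> (mdegree (sh a) == D) = (deg a.2 == d%:Z).
  move=> aq; have : (mdegree (sh a))%:Z = deg a.2 + (mdegree top)%:Z.
    rewrite !mdegreeE -degreeD; congr degree; apply/rowP=> i.
    by rewrite !mxE !mnmE gez0_abs // qN.
  by rewrite /D; move: (mdegree (sh a)) (mdegree top) (deg a.2); lia.
pose t a := iota a.1 * mmap1 y (sh a).
have tE a : a \in q -> t a = mmap1 y top * (iota a.1 * mono y a.2).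
  move=> aq; rewrite /t topE mulrCA -monoD // -mono_nat; congr (_ * mono y _).
  by apply/rowP=> i; rewrite !mxE mnmE gez0_abs ?qN // addrC.
have xE : mmap1 y top * x = \sum_(a <- q) t a.
  by rewrite xq /lsum mulr_sumr big_seq [RHS]big_seq; apply: eq_bigr => a aq;
    rewrite tE.
(* The components of the identity xE, both sides brought to the left. *)
pose c l := \sum_(a <- q | mdegree (sh a) == l) t a - (mmap1 y top * x) *+ (l == D).
have gc l : gr l (c l).
  apply: gr_add; first by apply: gr_sum => a /eqP <-; apply: gr_scale;
    apply: gr_monomial.
  apply: gr_opp; case: eqP => [->|_]; last exact: gr_zero grading _.
  by rewrite mulr1n mulrC; apply: (gr_mul grading) => //; apply: gr_monomial.
pose B := (D + \sum_(a <- q) mdegree (sh a)).+1.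
have sum0 : \sum_(l < B) c l = 0.
  have DB : (D < B)%N by rewrite ltnS leq_addr.
  rewrite sumrB [X in _ - X](bigD1 (Ordinal DB)) //= eqxx mulr1n.
  rewrite [X in _ - (_ + X)]big1 ?addr0; last first.
    by move=> l; rewrite -val_eqE /= => /negbTE ->.
  under eq_bigr do rewrite big_mkcond.
  rewrite exchange_big xE -sumrB big_seq big1 // => a aq /=.
  have aB : (mdegree (sh a) < B)%N.
    by rewrite ltnS (big_rem a) //= addnCA leq_addr.
  rewrite (bigD1 (Ordinal aB)) //= eqxx big1 ?addr0 ?subrr // => l.
  by rewrite -val_eqE /= eq_sym => /negbTE ->.
have DB : (D < B)%N by rewrite ltnS leq_addr.
have /eqP := gr_direct grading gc sum0 DB.
rewrite /c eqxx mulr1n subr_eq0 eq_sym => /eqP xD.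
exists [seq a <- q | deg a.2 == d%:Z]; last by move=> a;
  rewrite mem_filter => /andP[/eqP].
have top0 : mmap1 y top != 0 by rewrite topE mono_neq0.
apply: (mulfI top0);
  rewrite xD /lsum big_filter mulr_sumr big_seq_cond [RHS]big_seq_cond.
apply: eq_big => [a|a /andP[aq _]]; last exact: tE.
by case aq: (a \in q); rewrite //= degE.
Qed.

Lemma gr_above_expansion d x : gr_above gr d x ->
  exists2 q, x = ev q & forall a, a \in q -> d%:Z < deg a.2.
Proof.
move=> [N [c [gc ->]]].
elim: N => [|N [q e qd]]; first by exists [::] => //;
  rewrite big_geq // /lsum big_nil.
case: (ltnP d N) => [lt_dN|le_Nd]; last first.
  by exists [::] => //; rewrite big_geq // /lsum big_nil.
have [q' e' q'd] := gr_expansion (gc N).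
exists (q ++ q'); first by rewrite big_nat_recr //= lsum_cat -e -e'.
move=> a; rewrite mem_cat => /orP[/qd //|/q'd ->]; lia.
Qed.

(** [gr_above gr d] is [gr_from d.+1]; starting at d allows induction on d. *)
Definition gr_from d x := exists (N : nat) (c : nat -> F),
  (forall l, gr l (c l)) /\ x = \sum_(d <= l < N) c l.

Lemma gr_fromP d x : gr_from d x <-> exists (N : nat) (c : nat -> F),
  [/\ forall l, gr l (c l), forall l, (l < d)%N -> c l = 0 & x = \sum_(l < N) c l].
Proof.
split=> [[N [c [gc ->]]]|[N [c [gc c0 ->]]]].
  exists N, (fun l => if (d <= l)%N then c l else 0); split=> [l|l|].
  - by case: ifP => // _; apply: gr_zero grading _.
  - by rewrite ltnNge => /negbTE ->.
  - by rewrite (big_nat_widenl _ 0) //= big_mkcond big_mkord.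
exists N, c; split=> //.
rewrite [RHS](big_nat_widenl _ 0) //= [RHS]big_mkcond [RHS]big_mkord /=.
by apply: eq_bigr => l _; case: leqP => // /c0.
Qed.

Lemma gr_from_add d x x' : gr_from d x -> gr_from d x' -> gr_from d (x + x').
Proof.
move=> /gr_fromP[N [c [gc c0 ->]]] /gr_fromP[N' [c' [gc' c0' ->]]].
apply/gr_fromP; exists (maxn N N').
exists (fun l => (if (l < N)%N then c l else 0) + (if (l < N')%N then c' l else 0)).
split=> [l|l ld|].
- by apply: gr_add; case: ifP => // _; apply: gr_zero grading _.
- by rewrite c0 // c0' // !if_same addr0.
rewrite big_split /= -!big_mkcond /=; congr (_ + _).
  by rewrite (big_ord_widen _ c (leq_maxl N N')).
by rewrite (big_ord_widen _ c' (leq_maxr N N')).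
Qed.

Lemma gr_from_opp d x : gr_from d x -> gr_from d (- x).
Proof.
move=> [N [c [gc ->]]]; exists N, (fun l => - c l); split=> [l|];
  last by rewrite sumrN.
exact: gr_opp.
Qed.

Lemma gr_from0 d : gr_from d 0.
Proof.
by exists 0%N, (fun _ => 0); split;
  [move=> l; apply: gr_zero grading _|rewrite big_geq].
Qed.

Lemma gr_from_weaken d d' x : (d' <= d)%N -> gr_from d x -> gr_from d' x.
Proof.
move=> dd /gr_fromP[N [c [gc c0 ->]]]; apply/gr_fromP; exists N, c; split=> // l ld.
by apply: c0; apply: leq_trans dd.
Qed.

Lemma gr_from_gr d x : gr d x -> gr_from d x.
Proof.
move=> gx; exists d.+1, (fun l => if l == d then x else 0); split=> [l|].
  by case: eqP => [->//|_]; apply: gr_zero grading _.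
by rewrite big_nat1 eqxx.
Qed.

Variable phi : F -> F.
Hypothesis A_add : forall a b, A a -> A b -> A (a + b).
Hypothesis phi_add : forall a b, A a -> A b -> phi (a + b) = phi a + phi b.
Hypothesis phi0 : phi 0 = 0.
Hypothesis unip : is_unipotent gr phi.

Lemma A0 : A 0.
Proof. exact: (gr_sub grading (gr_zero grading 0)). Qed.

Lemma unipotent_from d x : gr_from d x -> gr_from d.+1 (phi x - x).
Proof.
move=> /gr_fromP[N [c [gc c0 ->]]].
have -> : phi (\sum_(l < N) c l) - \sum_(l < N) c l = \sum_(l < N) (phi (c l) - c l).
  rewrite sumrB; congr (_ - _); elim: N => [|N IH]; first by rewrite !big_ord0 phi0.
  rewrite !big_ord_recr /= phi_add ?IH //; last exact: (gr_sub grading (gc N)).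
  by elim/big_ind: _ => [|a b|i _];
    [exact: A0|exact: A_add|exact: (gr_sub grading (gc i))].
elim/big_ind: _ => [|a b|l _]; [exact: gr_from0|exact: gr_from_add|].
have [ld|dl] := ltnP l d; first by rewrite c0 // phi0 subrr; apply: gr_from0.
by apply: (@gr_from_weaken l.+1) => //; apply: unip.
Qed.

(** The inverse of a unipotent map is unipotent: phi and the identity agree on
    lowest components, so x starts in the same degree d as phi x. *)
Lemma unipotent_inverse d x : A x -> gr d (phi x) -> gr_above gr d (x - phi x).
Proof.
move=> Ax gx.
have step (e : nat) : (e <= d)%N -> gr_from e x.
  elim: e => [_|e IH ed].
    have [N [c [gc xE]]] := gr_span grading Ax.
    by apply/gr_fromP; exists N, c; split.
  have -> : x = phi x + - (phi x - x) by rewrite opprB addrC subrK.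
  apply: gr_from_add; first by apply: gr_from_weaken ed _; apply: gr_from_gr.
  by apply: gr_from_opp; apply: unipotent_from; apply: IH; apply: ltnW.
by rewrite -opprB; apply: gr_from_opp; apply: unipotent_from; apply: step.
Qed.

End GradedSubalgebra.

(** * Unipotent Poisson automorphisms *)

Section ClusterPoissonAutomorphisms.
Import mpoly.
Variables (K F : fieldType) (iota : {rmorphism K -> F}).

Lemma attached_matrix (n r : nat) (s t : seed F n r) (L : 'M[int]_(n + r)) :
  mut_equiv s t -> L^T = - L -> exists2 M, attached s L t M & M^T = - M.
Proof.
move=> st Lskew; elim: st => [|k u _ [M sM Mskew]].
  by exists L => //; apply: attached_refl.
exists (mutate_compat k (exmx u) M); first exact: attached_step.
by rewrite /mutate_compat !trmx_mul trmxK Mskew mulNmx mulmxN mulmxA.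
Qed.

Lemma is_seed_good (n r : nat) (s : seed F n r) d L :
  is_seed iota s -> skew_symmetrizes d (exmx s) -> compatible d (exmx s) L ->
  good_seed iota s.
Proof.
move=> [[ind gen] _] sk cL; split=> //.
- by exists d; apply: skew_symmetrizes_data.
- by case: sk => d0 _; apply: compatible_left_invertible d0 cL.
Qed.

(** The Laurent monomials themselves need not lie in A; multiply by a monomial in the
    y_i with nonnegative exponents to compute inside A. *)
Lemma algebra_map_expansion (m : nat) (y : 'I_m -> F) (A : F -> Prop)
    (phi : F -> F) q :
  (forall c, A (iota c)) -> (forall a b, A a -> A b -> A (a + b)) ->
  (forall a b, A a -> A b -> A (a * b)) -> (forall i, A (y i)) ->
  (forall c, phi (iota c) = iota c) ->
  (forall a b, A a -> A b -> phi (a + b) = phi a + phi b) ->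
  (forall a b, A a -> A b -> phi (a * b) = phi a * phi b) ->
  (forall i, y i != 0) -> (forall i, phi (y i) != 0) ->
  A (lsum iota (mono y) q) ->
  phi (lsum iota (mono y) q) = lsum iota (mono (phi \o y)) q.
Proof.
move=> AK AD AM Ay phiK phiD phiM y0 py0 Aq.
have A1 : A 1 by rewrite -(rmorph1 iota).
have phi1 : phi 1 = 1 by rewrite -(rmorph1 iota) phiK.
have phi0 : phi 0 = 0 by rewrite -(rmorph0 iota) phiK.
have A0 : A 0 by rewrite -(rmorph0 iota).
pose G x z := A x /\ phi x = z.
have GM x z x' z' : G x z -> G x' z' -> G (x * x') (z * z').
  by move=> [Ax <-] [Ax' <-]; split; [exact: AM|exact: phiM].
have GD x z x' z' : G x z -> G x' z' -> G (x + x') (z + z').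
  by move=> [Ax <-] [Ax' <-]; split; [exact: AD|exact: phiD].
have Gmon a : G (mmap1 y a) (mmap1 (phi \o y) a).
  rewrite /mmap1; elim/big_ind2: _ => [//|x z x' z'|i _]; first exact: GM.
  by elim: (a i) => [//|j IH]; rewrite !exprS; apply: GM.
have Gpoly p : G (mmap iota y p) (mmap iota (phi \o y) p).
  rewrite /mmap; elim/big_ind2: _ => [//|x z x' z'|a _]; first exact: GD.
  by apply: GM.
have [N qN] := exponents_bounded q.
have [_] := Gpoly (polynomial_of N q).
rewrite !(mmap_polynomial_of _ _ qN) //.
have e : mono y (const_mx N%:Z) = mmap1 y [multinom N | i < m].
  by rewrite -mono_nat; congr mono; apply/rowP=> i; rewrite !mxE mnmE.
have e' : mono (phi \o y) (const_mx N%:Z) = mmap1 (phi \o y) [multinom N | i < m].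
  by rewrite -mono_nat; congr mono; apply/rowP=> i; rewrite !mxE mnmE.
have [Amon phimon] := Gmon [multinom N | i < m].
rewrite e phiM // phimon -e'; apply: mulfI.
by apply: mono_neq0 => i /=.
Qed.

End ClusterPoissonAutomorphisms.

Theorem theorem3p6 (K F : fieldType) (iota : {rmorphism K -> F}) (n r : nat)
    (Sigma0 : seed F n r) (br : F -> F -> F) (gr : nat -> F -> Prop)
    (Sigma : seed F n r) (brL : F -> F -> F) (phi : F -> F)
    (charK : [pchar K] =i pred0)
    (seed0 : is_seed iota Sigma0)
    (gsv : is_GSV iota Sigma0 br)
    (grading : is_grading iota (cluster_algebra iota Sigma0) gr)
    (seedSigma : mut_equiv Sigma0 Sigma)
    (homog : forall k : 'I_(n + r),
        exists2 e : nat, (0 < e)%N & gr e (cvar Sigma k))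
    (induced : induced_bracket iota Sigma0 Sigma br brL)
    (aut : is_poisson_aut iota (cluster_algebra iota Sigma0) br phi)
    (unip : is_unipotent gr phi) :
  forall k : 'I_(n + r),
    poisson_center (laurent_ring iota Sigma) brL
      (phi (cvar Sigma k) / cvar Sigma k).
Proof.
pose A := cluster_algebra iota Sigma0; pose y := cvar Sigma.
have [brP [d [L [sk _ cL br_attached]]]] := gsv.
have [brLP brLE] := induced.
have good0 := is_seed_good seed0 sk cL.
have goodS := good_mut_equiv charK good0 seedSigma.
have ind := good_indep goodS.
have y0 : forall i, y i != 0 by exact: indep_neq0 ind.
have natF0 := natF_eq0 iota charK.
have [M attM Mskew] := attached_matrix seedSigma cL.1.
have Alau x : A x -> laurent_ring iota Sigma x.
  by move=> Ax; apply: (laurent_phenomenon charK good0 seedSigma Ax).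
have Ay i : A (y i) by apply: subalg_in; exists Sigma, i.
have brL_y j k : brL (y j) (y k) = (M j k)%:~R * (y j * y k).
  by rewrite (brLE _ _ (Ay j) (Ay k)) (br_attached _ _ attM).
have PE x : laurent_ring iota Sigma x <->
  subalg_gen iota (fun x => exists i, x = y i \/ x = (y i)^-1) x by [].
have [wt wt0 gr_y] := fin_all_exists2 homog.
pose unit k : 'rV[int]_(n + r) := delta_mx 0 k.
pose ev := lsum iota (mono y).
(* Unipotency in Laurent coordinates: the quotient of z by y_k is 1 plus terms of
   positive degree. *)
have higher_terms k z : gr_above gr (wt k) (z - y k) ->
    exists q, [/\ z = y k * ev ((1, 0) :: q),
      forall x, x \in q -> 0 < degree wt x.2,
      uniq (map snd q) & forall x, x \in q -> x.1 != 0].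
  move=> /(gr_above_expansion ind grading gr_y Alau)[q zq qd].
  have [q' [q'E q'u q'n q'q]] := lsum_normal ind (lshiftl (- unit k) q).
  exists q'; split=> // [|x /q'q[_ /mapP[a aq ->] /= <-]]; last first.
    by rewrite degreeD degreeN degree_unit addrC subr_gt0; apply: qd.
  rewrite /ev /lsum big_cons -/(lsum iota (mono y) q') q'E.
  rewrite lsum_shift => [|a _]; last exact: (monoD _ _ y0).
  rewrite /= rmorph1 mono_row0 monoN // mono_delta mulrDr !mulr1 mulVKf //.
  by rewrite -zq addrC subrK.
have phiy0 i : phi (y i) != 0.
  apply/eqP=> py0.
  have A0 : A 0 by exact: subalg0.
  have := aut_inj aut (Ay i) A0; rewrite py0 -{1 2}(rmorph0 iota) (aut_scalar aut).
  by move=> /(_ erefl) yi; have := y0 i; rewrite yi eqxx.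
have phi_terms k := higher_terms k _ (unip _ _ (gr_y k)).
have [f fP] := fin_all_exists phi_terms.
have inverse_terms k : exists q,
    [/\ exists a, [/\ A a, phi a = y k & a = y k * ev ((1, 0) :: q)],
      forall x, x \in q -> 0 < degree wt x.2,
      uniq (map snd q) & forall x, x \in q -> x.1 != 0].
  have [a Aa pa] := aut_surj aut (Ay k).
  have : gr_above gr (wt k) (a - y k).
    rewrite -pa; apply: (unipotent_inverse grading _ _ _ unip) => //.
    - by move=> b c; apply: subalg_add.
    - exact: aut_add aut.
    - by rewrite -(rmorph0 iota) (aut_scalar aut).
    - by rewrite pa.
  by case/higher_terms=> q [aq qd qu qn]; exists q; split=> //; exists a.
have [g gP] := fin_all_exists inverse_terms.
pose u k := ev ((1, 0) :: f k).
have uE k : phi (y k) = y k * u k by case: (fP k).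
have u0 k : u k != 0 by have := phiy0 k; rewrite uE mulf_eq0 negb_or => /andP[].
have evshift k q : y k * ev q = ev (lshiftl (unit k) q).
  rewrite /ev lsum_shift => [|x _]; last exact: (monoD _ _ y0).
  by rewrite mono_delta.
have central : forall k x, x \in f k -> forall j,
    skew_form M (unit j) x.2 = 0.
  apply: (@rigidity _ _ iota _ y M wt natF0 ind Mskew f g).
  - by move=> k; case: (fP k).
  - by move=> k; case: (gP k).
  - by move=> k; case: (fP k).
  - by move=> k; case: (gP k).
  - by move=> k; case: (fP k).
  - by move=> k; case: (gP k).
  (* The bracket of phi (y j) and phi (y k), computed in two ways. *)
  - move=> j k; apply: (mulfI (mulf_neq0 (y0 j) (y0 k))); rewrite mulr0.
    have e : brL (phi (y j)) (phi (y k)) = (M j k)%:~R * (phi (y j) * phi (y k)).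
      have Apy i : A (phi (y i)) := aut_closed aut (Ay i).
      have AM : A (y j * y k) by exact: subalg_mul (Ay j) (Ay k).
      have AMjk : A (iota (M j k)%:~R) by exact: subalg_scalar.
      rewrite (brLE _ _ (Apy j) (Apy k)) -(aut_br aut (Ay j) (Ay k)).
      rewrite -(brLE _ _ (Ay j) (Ay k)) brL_y -(rmorph_int iota).
      by rewrite (aut_mul aut AMjk AM) (aut_scalar aut) (aut_mul aut (Ay j) (Ay k)).
    have phiE i : phi (y i) = ev (lshiftl (unit i) ((1, 0) :: f i)).
      by rewrite -evshift; case: (fP i).
    move/eqP: e; rewrite [in brL _ _](phiE j) [in brL _ _](phiE k) !uE.
    rewrite (br_ev y0 Mskew PE brLP brL_y) -subr_eq0 => /eqP <-.
    have uu : u j * u k = \sum_(a <- (1, 0) :: f j) \sum_(b <- (1, 0) :: f k)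
        iota (a.1 * b.1) * mono y (a.2 + b.2).
      rewrite /u /ev -lsum_mul => [|a b _ _]; last exact: (monoD _ _ y0).
      exact: big_allpairs_dep.
    rewrite [X in _ - _ * X]mulrACA uu [X in _ * X = _]/lsum big_allpairs_dep.
    rewrite [X in _ = X - _]big_map mulrA !mulr_sumr -sumrB.
    apply: eq_bigr => a _; rewrite big_map !mulr_sumr -sumrB.
    apply: eq_bigr => b _ /=.
    rewrite !(monoD _ _ y0) /unit !mono_delta !rmorphM rmorph_int rmorphB /=.
    ring.
  (* Expand phi a = y k, where a is the preimage of y k. *)
  - move=> k; have [[a [Aa pa aE]] _ _ _] := gP k.
    have phia : phi a = phi (y k) * lsum iota (mono (phi \o y)) ((1, 0) :: g k).
      rewrite aE evshift (@algebra_map_expansion _ _ iota _ y A) //.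
      + rewrite lsum_shift => [|b _]; last exact: (monoD _ _ phiy0).
        by rewrite mono_delta.
      + exact: subalg_scalar.
      + exact: subalg_add.
      + exact: subalg_mul.
      + exact: aut_scalar aut.
      + exact: aut_add aut.
      + exact: aut_mul aut.
      + by rewrite -/(ev _) -evshift -aE.
    apply: (mulfI (y0 k)); rewrite mulr1 mulrA -/(ev _) -/(u k) -uE -[LHS]pa phia.
    congr (_ * _); apply: eq_bigr => b _.
    rewrite -mulrA -monoM; congr (_ * _); apply: eq_mono => i /=.
    exact: uE.
  - exact: u0.
move=> k; have xs := central k.
have uk : phi (y k) / y k = u k by rewrite uE mulrAC divff // mul1r.
rewrite -/y uk; split.
  exact: (laurent_ev PE).
move=> x /PE /(laurent_expansion y0)[q ->]; rewrite /u /ev.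
rewrite (br_ev y0 Mskew PE brLP brL_y) big_seq big1 // => a aF.
apply: big1 => b _.
have -> : skew_form M a.2 b.2 = 0; last by rewrite mulr0 mul0r.
rewrite (skew_form_antisym Mskew) skew_formE big1 ?oppr0 // => i _.
move: aF; rewrite inE => /predU1P[->|/xs ->]; last by rewrite mulr0.
by rewrite /= (skew_form_antisym Mskew) skew_formE big1 ?oppr0 ?mulr0 // => i' _;
  rewrite mxE mul0r.
Qed.
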